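(* Let $L$ be an even lattice in the non-degenerate rational quadratic space $V$, let $U\subseteq V$ be an isotropic subspace, put $I=U\cap L$, and use the coordinates on $\mathcal{P}_{U}$ and on $\overline{\mathcal{P}}_{U}$ arising from a complement $\tilde{U}=\tilde{I}_{\mathbb{Q}}$, where $\tilde I\subseteq L^*$ is a sublattice whose pairing with $I$ is unimodular (all notation as in the context). Then: (1) The intersection $\Gamma_{L}\cap\mathcal{W}_{U}$ is precisely the integral Heisenberg group $H\big(\mathrm{Hom}(\Lambda^{*},I),\mathrm{Hom}^{as}(I^{*},I)\big)$, i.e., it is the set of pairs $(\psi,\eta)\in\mathrm{Hom}(\Lambda^{*},I)\times\mathrm{Hom}^{as}(I^{*},\tfrac{1}{2}I)$ such that $\frac{\psi\psi^{*}}{2}+\eta\in\mathrm{Hom}(I^{*},I)$. (2) There is a cocycle $b:\mathrm{SL}(I_{L^{*}},I)\to\mathrm{Hom}(\Lambda,I)/\mathrm{Hom}(\Lambda^{*},I)$, $M\mapsto b_M$ (that is, $b_{MN}=b_M+M(b_N)$, with $M$ acting by composition on the left), such that the image $\overline{\Gamma}_{L,I}$ of $\Gamma_{L,I}$ in $\overline{\mathcal{P}}_{U}$ consists of those triples $(M,\gamma,\psi)$ of $M\in\mathrm{SL}(U)$, $\gamma\in\mathrm{O}(W)$, and $\psi\in\mathrm{Hom}_{\mathbb{Q}}(W,U)$ for which $M$ is in $\mathrm{SL}(I_{L^{*}},I)$, $\gamma$ is in $\Gamma_{\Lambda}$, and $\psi$ is in $\mathrm{Hom}(\Lambda,I)$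 such that the image of $\psi$ modulo $\mathrm{Hom}(\Lambda^{*},I)$ is $b_M$.
   Context: **Lattices.** $V$ is a finite-dimensional $\mathbb{Q}$-vector space with a non-degenerate symmetric bilinear form $(\cdot,\cdot)$; $v^2:=(v,v)$. $L\subseteq V$ is an even lattice: a finitely generated subgroup of full rank with $(\lambda,\lambda)\in2\mathbb{Z}$ for all $\lambda\in L$. $L^*=\{\nu\in V:(\nu,L)\subseteq\mathbb{Z}\}\supseteq L$. $U\subseteq V$ is isotropic, i.e. $U\subseteq U^\perp$; $W=U^\perp/U$ with its induced non-degenerate form. Put $I=U\cap L$, $I_{L^*}=U\cap L^*$, $I^\perp_L=U^\perp\cap L$, $I^\perp_{L^*}=U^\perp\cap L^*$. Then $\Lambda=I^\perp_L/I\subseteq W$ is an even lattice, with dual $\Lambda^*=I^\perp_{L^*}/I_{L^*}\subseteq W$. For vector spaces $X^*$ denotes the dual vector space; for lattices it denotes the $\mathbb{Z}$-dual. For lattices $J\subseteq X$, $J'\subseteq X'$ spanning $X,X'$ over $\mathbb{Q}$, $\mathrm{Hom}(J,J')$ is viewed inside $\mathrm{Hom}_{\mathbb{Q}}(X,X')$ as the maps sending $J$ into $J'$. **Groups.** $\mathcal{P}_U$ is the stabilizer of $U$ in $\mathrm{O}(V)$. An element $A\in\mathcal{P}_U$ maps to $(M,\gamma)\in\mathrm{GL}(U)\times\mathrm{O}(W)$, where $M=A|_U$ and $\gamma$ is the map induced on $W$; $\mathcal{W}_U$ is the kernel of this map. $\mathrm{SO}^+(V_{\mathbb{R}})$ is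 the identity component of $\mathrm{O}(V_{\mathbb{R}})$; $\Gamma_L$ is the group of automorphisms of $L$ lying in $\mathrm{SO}^+(V_{\mathbb{R}})$ and acting trivially on $L^*/L$; $\Gamma_\Lambda$ is defined similarly for $\Lambda\subseteq W$. $\mathcal{P}^0_{U_{\mathbb{R}}}$ is the identity component of $\mathcal{P}_{U_{\mathbb{R}}}$ and $\Gamma_{L,I}=\mathcal{P}^0_{U_{\mathbb{R}}}\cap\Gamma_L$. $\mathrm{SL}(I)$ is the group of determinant 1 automorphisms of $I$, and $\mathrm{SL}(I_{L^*},I)=\{M\in\mathrm{SL}(I):u-Mu\in I\ \forall u\in I_{L^*}\}$. **Complement and coordinates.** A sublattice $\tilde I\subseteq L^*$ has unimodular pairing with $I$ if the map $\tilde I\to I^*=\mathrm{Hom}(I,\mathbb{Z})$ induced by the (integral) pairing is an isomorphism (such $\tilde I$ exist). Put $\tilde U=\tilde I_{\mathbb{Q}}$, a complement of $U^\perp$ in $V$ (not necessarily isotropic). The pairing identifies $\tilde U\cong V/U^\perp\cong U^*$, and $\tilde W:=(U\oplus\tilde U)^\perp\cong W$, so $V=U\oplus\tilde W\oplus\tilde U$. A tilde denotes transport of maps through $W\cong\tilde W$, $U^*\cong\tilde U$. For $\psi\in\mathrm{Hom}_{\mathbb{Q}}(W,U)$, $\psi^*:U^*\to W$ is its dual (using $W^*\cong W$), and $M^{-*}=(M^* )^{-1}$. A map $\eta:U^*\to U$ is (anti-)symmetric if $(u^*,v^* )\mapsto(u^*,\eta v^* )$ is; $\mathrm{Hom}^{as}$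 denotes anti-symmetric maps. Let $\alpha:\tilde U\to U$ be the unique symmetric map such that $\{\tilde u-\alpha\tilde u:\tilde u\in\tilde U\}$ is isotropic. Every $A\in\mathcal{P}_U$ corresponds bijectively to $(M,\gamma,\psi,\eta)\in\mathrm{GL}(U)\times\mathrm{O}(W)\times\mathrm{Hom}_{\mathbb{Q}}(W,U)\times\mathrm{Hom}^{as}_{\mathbb{Q}}(U^*,U)$ via $Au=Mu$ ($u\in U$), $Aw=\tilde\gamma w-\tilde\psi\tilde\gamma w$ ($w\in\tilde W$), and, for $\tilde u\in\tilde U$, $$A\tilde u=\widetilde{M^{-*}}\tilde u+\widetilde{\psi^*}\widetilde{M^{-*}}\tilde u+\Big(M\alpha\tilde u-\alpha\widetilde{M^{-*}}\tilde u-\tfrac12\tilde\psi\widetilde{\psi^*}\widetilde{M^{-*}}\tilde u-\tilde\eta\widetilde{M^{-*}}\tilde u\Big).$$ $\mathcal{W}_U$ consists of the elements with $M=\mathrm{Id}$, $\gamma=\mathrm{Id}$, written $(\psi,\eta)$, with product $(\psi,\eta)(\varphi,\rho)=\big(\psi+\varphi,\eta+\rho+\frac{\psi\varphi^*-\varphi\psi^*}{2}\big)$. The group $\overline{\mathcal{P}}_U=\mathcal{P}_U/\mathrm{Hom}^{as}_{\mathbb{Q}}(U^*,U)$ has coordinates $(M,\gamma,\psi)$ with product $(M,\gamma,\psi)(N,\delta,\varphi)=(MN,\gamma\delta,\psi+M\varphi\gamma^{-1})$. The group $\mathrm{SL}(I)$ acts on $\mathrm{Hom}(\Lambda,I)/\mathrm{Hom}(\Lambda^*,I)$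 by composition on the left. *)

(* Defs.v *)
From HB Require Import structures.
From mathcomp Require Import all_boot all_order all_algebra.
From mathcomp Require Import all_classical all_reals all_analysis.
From mathcomp Require Import sesquilinear.

Set Implicit Arguments.
Unset Strict Implicit.
Unset Printing Implicit Defensive.

Import Order.TTheory GRing.Theory Num.Theory.
Import numFieldNormedType.Exports.
Import passmx.

Local Open Scope classical_set_scope.
Local Open Scope ring_scope.

(** * Linear algebra *)

Definition dual (X : vectType rat) : vectType rat := 'Hom(X, rat^o).

Definition dual_map (X Y : vectType rat) (f : 'Hom(X, Y)) :
    'Hom(dual Y, dual X) :=
  linfun (fun g : dual Y => (g \o f)%VF : dual X).

Definition end_det (X : vectType rat) (f : 'End(X)) : rat :=
  \det (mxof (vbasis {:X}) (vbasis {:X}) f).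

Definition antisymmetric_map (X : vectType rat) (eta : 'Hom(dual X, X)) :=
  forall f g : dual X, f (eta g) = - g (eta f).

(* The isomorphism of X with its dual given by a non-degenerate form. *)
Definition flat (X : vectType rat) (B : {symmetric X}) : 'Hom(X, dual X) :=
  linfun (fun x : X => linfun (fun y : X => B x y : rat^o) : dual X).

(* psi^* : Y^* -> X^*, followed by the identification of X^* with X; the
   operation ^-1 on linear maps is the inverse on isomorphisms. *)
Definition adjoint (X Y : vectType rat) (B : {symmetric X})
    (psi : 'Hom(X, Y)) : 'Hom(dual Y, X) :=
  ((flat B)^-1 \o dual_map psi)%VF.

Definition pairing (V : vectType rat) (B : {symmetric V}) (U : {vspace V})
    (v : V) : dual (subvs_of U) :=
  linfun (fun u : subvs_of U => B v (vsval u) : rat^o).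

(** * Lattices *)

Definition is_lattice (V : vectType rat) (X : {vspace V}) (J : set V) :=
  exists (m : nat) (s : m.-tuple V),
    << s >>%VS = X /\ J = [set v | inIntSpan s v].

Definition even_lattice (V : vectType rat) (B : {symmetric V}) (L : set V) :=
  is_lattice fullv L /\ forall x, L x -> B x x / 2 \is a Num.int.

Definition dual_lattice (V : vectType rat) (B : {symmetric V}) (L : set V) :
    set V :=
  [set nu | forall x, L x -> B nu x \is a Num.int].

Definition lattice_in (V : vectType rat) (U : {vspace V}) (L : set V) :
    set (subvs_of U) :=
  [set u | L (vsval u)].
Arguments lattice_in {V} U L.

Definition Zdual (X : vectType rat) (J : set X) : set (dual X) :=
  [set f | forall x, J x -> f x \is a Num.int].

Definition half_lattice (X : vectType rat) (J : set X) : set X :=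
  [set x | J (2 *: x)].

Definition Hom_lattice (X Y : vectType rat) (J : set X) (J' : set Y) :
    set 'Hom(X, Y) :=
  [set f | forall x, J x -> J' (f x)].

(* The class of psi modulo the subgroup K of Hom(X, Y). *)
Definition Hom_class (X Y : vectType rat) (K : set 'Hom(X, Y))
    (psi : 'Hom(X, Y)) : set 'Hom(X, Y) :=
  [set phi | K (phi - psi)].

(** * Real points and identity components *)

(* X_R is R^n through the coordinates in the basis vbasis {:X} of X; linear
   maps act on row vectors from the right, and matrices carry their usual
   topology. *)

Definition real_mx (R : realType) (X : vectType rat) (f : 'End(X)) :
    'M[R]_(\dim {:X}) :=
  map_mx ratr (mxof (vbasis {:X}) (vbasis {:X}) f).

Definition real_gram (R : realType) (X : vectType rat) (B : {symmetric X}) :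
    'M[R]_(\dim {:X}) :=
  \matrix_(i, j) ratr (B (vbasis {:X})`_i (vbasis {:X})`_j).

Definition real_vspace (R : realType) (X : vectType rat) (U : {vspace X}) :
    'M[R]_(\dim {:X}) :=
  map_mx ratr (msof (vbasis {:X}) U).

Definition real_O (R : realType) (X : vectType rat) (B : {symmetric X}) :
    set 'M[R]_(\dim {:X}) :=
  [set A | A *m real_gram R B *m A^T = real_gram R B].

Definition real_SOplus (R : realType) (X : vectType rat)
    (B : {symmetric X}) : set 'M[R]_(\dim {:X}) :=
  connected_component (real_O B) 1%:M.

Definition real_parabolic (R : realType) (X : vectType rat)
    (B : {symmetric X}) (U : {vspace X}) : set 'M[R]_(\dim {:X}) :=
  [set A | real_O B A /\ (real_vspace R U *m A == real_vspace R U)%MS].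

Definition real_parabolic0 (R : realType) (X : vectType rat)
    (B : {symmetric X}) (U : {vspace X}) : set 'M[R]_(\dim {:X}) :=
  connected_component (real_parabolic B U) 1%:M.

(** * Arithmetic groups *)

Definition Gamma (R : realType) (X : vectType rat) (B : {symmetric X})
    (L : set X) : set 'End(X) :=
  [set A : 'End(_) | [/\ isometry B B A,
               A @` L = L,
               real_SOplus B (real_mx R A) &
               forall nu, dual_lattice B L nu -> L (A nu - nu)]].

Definition Gamma_LI (R : realType) (V : vectType rat) (B : {symmetric V})
    (U : {vspace V}) (L : set V) : set 'End(V) :=
  [set A : 'End(V) | real_parabolic0 B U (real_mx R A) /\ Gamma R B L A].

Definition SL (X : vectType rat) (J : set X) : set 'End(X) :=
  [set M | end_det M = 1 /\ M @` J = J].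

(* SL(J', J) for lattices J \subset J'. *)
Definition SL_rel (X : vectType rat) (J' J : set X) : set 'End(X) :=
  [set M | SL J M /\ forall u, J' u -> J (u - M u)].

(** * The quotient W of the orthogonal complement of U by U *)

(* (W, BW), with the projection p, is U^\perp / U with the induced form. *)
Definition is_subquotient (V : vectType rat) (B : {symmetric V})
    (U : {vspace V}) (W : vectType rat) (BW : {symmetric W})
    (p : 'Hom(subvs_of (orthov B U), W)) :=
  [/\ limg p = fullv,
      forall x, (p x == 0) = (vsval x \in U) &
      forall x y, BW (p x) (p y) = B (vsval x) (vsval y)].

Section RestrictedForm.
Variables (V : vectType rat) (B : {symmetric V}) (X : {vspace V}).

Definition restricted_form (x y : subvs_of X) : rat := B (vsval x) (vsval y).

Let restricted_form_linearl u :
  GRing.linear_for ( *%R : rat -> rat -> rat) (restricted_form ^~ u).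
Proof. by move=> a x y; exact: linearPl. Qed.

Let restricted_form_linearr u :
  GRing.linear_for (idfun \; *%R : rat -> rat -> rat) (restricted_form u).
Proof. by move=> a x y; exact: linearPr. Qed.

HB.instance Definition _ :=
  bilinear_isBilinear.Build rat (subvs_of X) (subvs_of X) rat _ _
    restricted_form (restricted_form_linearl, restricted_form_linearr).

Let restricted_form_sym x y :
  restricted_form x y = (-1) ^+ false * idfun (restricted_form y x).
Proof. by rewrite /restricted_form hermC. Qed.

HB.instance Definition _ :=
  isHermitianSesquilinear.Build rat (subvs_of X) false idfun
    restricted_form restricted_form_sym.

End RestrictedForm.

Lemma subquotient_exists (V : vectType rat) (B : {symmetric V})
    (U : {vspace V}) : (U <= orthov B U)%VS ->
  exists (W : vectType rat) (BW : {symmetric W})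
         (p : 'Hom(subvs_of (orthov B U), W)), is_subquotient BW p.
Proof.
move=> isoU; set P := orthov B U; set Q := (P :\: U)%VS.
have QP : (Q <= P)%VS by apply: diffvSl.
pose f (x : subvs_of P) : subvs_of Q := vsproj Q (addv_pi1 P U (vsval x)).
have flin : linear f by move=> a x y; rewrite /f !linearP.
pose fL := GRing.isSemilinear.Build _ _ _ _ f (GRing.semilinear_linear flin).
pose F : {linear subvs_of P -> subvs_of Q} := HB.pack f fL.
have fE x : vsval (linfun F x) = addv_pi1 P U (vsval x).
  by rewrite lfunE /= /f vsprojK //; exact: memv_pi.
have dec (x : subvs_of P) : vsval x = addv_pi1 P U (vsval x) + addv_pi2 P U (vsval x) :> V.
  rewrite addv_pi1_pi2 //; apply: (subvP (addvSl _ _)); exact: (subvsP x).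
have U2 (x : subvs_of P) : addv_pi2 P U (vsval x) \in U by exact: memv_pi2.
exists (subvs_of Q), (@restricted_form V B Q), (linfun F); split.
- apply/vspaceP => w; rewrite memvf; apply/memv_imgP.
  exists (vsproj P (vsval w)); rewrite ?memvf //; apply: val_inj => /=.
  rewrite fE vsprojK ?(subvP QP) ?subvsP //.
  by rewrite /addv_pi1 daddv_pi_id ?subvsP ?capv_diff.
- move=> x; rewrite -(inj_eq val_inj) /= [X in X == _]fE.
  apply/eqP/idP => [x0|xU]; first by rewrite dec x0 add0r.
  have := dec x; rewrite addv_pi2_id // => /eqP.
  by rewrite -[X in X == _]add0r (inj_eq (addIr _)) eq_sym => /eqP.
- move=> x y.
  change (B (vsval (linfun F x)) (vsval (linfun F y)) = B (vsval x) (vsval y)).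
  have {fE} [-> ->] := (fE x, fE y).
  have := dec x; have := dec y; have := U2 x; have := U2 y.
  have : addv_pi1 P U (vsval x) \in P by exact: memv_pi1.
  have : addv_pi1 P U (vsval y) \in P by exact: memv_pi1.
  move: (addv_pi1 P U (vsval x)) (addv_pi1 P U (vsval y)) => x1 y1.
  move: (addv_pi2 P U (vsval x)) (addv_pi2 P U (vsval y)) => x2 y2.
  move=> y1P x1P y2U x2U -> ->.
  have o u z : u \in U -> z \in P -> B z u = 0 by move=> uU /mem_orthovP; apply.
  rewrite linearDr !linearDl /= (o y2) // (o y2) ?(subvP isoU) //.
  by rewrite (hermC B x2) (o x2) // mulr0 !addr0.
Qed.

Definition Lambda (V : vectType rat) (B : {symmetric V}) (U : {vspace V})
    (W : vectType rat) (p : 'Hom(subvs_of (orthov B U), W)) (L : set V) :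
    set W :=
  p @` lattice_in (orthov B U) L.

(* The kernel of the map from the stabilizer of U to GL(U) x O(W). *)
Definition unipotent_radical (V : vectType rat) (B : {symmetric V})
    (U : {vspace V}) (W : vectType rat)
    (p : 'Hom(subvs_of (orthov B U), W)) : set 'End(V) :=
  [set A : 'End(_) | [/\ isometry B B A,
               (A @: U)%VS = U,
               forall u, u \in U -> A u = u &
               forall x, p (vsproj (orthov B U) (A (vsval x))) = p x]].

(** * Coordinates *)

Definition unimodular_complement (V : vectType rat) (B : {symmetric V})
    (L : set V) (U Ut : {vspace V}) (It : set V) :=
  [/\ is_lattice Ut It,
      It `<=` dual_lattice B L &
      set_bij It (Zdual (lattice_in U L)) (pairing B U)].

Section Coordinates.

Variables (V : vectType rat) (B : {symmetric V}) (U Ut : {vspace V}).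
Variables (W : vectType rat) (BW : {symmetric W}).
Variable p : 'Hom(subvs_of (orthov B U), W).

Definition Wt : {vspace V} := orthov B (U + Ut)%VS.

Definition Ut_dual : 'Hom(subvs_of Ut, dual (subvs_of U)) :=
  linfun (fun t : subvs_of Ut => pairing B U (vsval t)).

Definition Wt_W : 'Hom(subvs_of Wt, W) :=
  linfun (fun w : subvs_of Wt => p (vsproj (orthov B U) (vsval w))).

Definition is_alpha (alpha : 'Hom(subvs_of Ut, subvs_of U)) :=
  (forall s t, B (vsval s) (vsval (alpha t)) = B (vsval t) (vsval (alpha s)))
  /\ (forall s t, B (vsval s - vsval (alpha s)) (vsval t - vsval (alpha t)) = 0).

Variable alpha : 'Hom(subvs_of Ut, subvs_of U).

Section Element.

Variables (M : 'End(subvs_of U)) (gamma : 'End(W)).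
Variables (psi : 'Hom(W, subvs_of U)).
Variable eta : 'Hom(dual (subvs_of U), subvs_of U).

Let Mt : 'End(subvs_of Ut) :=
  (Ut_dual^-1 \o (dual_map M)^-1 \o Ut_dual)%VF.
Let gammat : 'End(subvs_of Wt) := (Wt_W^-1 \o gamma \o Wt_W)%VF.
Let psit : 'Hom(subvs_of Wt, subvs_of U) := (psi \o Wt_W)%VF.
Let psi_start : 'Hom(subvs_of Ut, subvs_of Wt) :=
  (Wt_W^-1 \o adjoint BW psi \o Ut_dual)%VF.
Let etat : 'Hom(subvs_of Ut, subvs_of U) := (eta \o Ut_dual)%VF.

Definition elt_U (u : subvs_of U) : V := vsval (M u).

Definition elt_Wt (w : subvs_of Wt) : V :=
  vsval (gammat w) - vsval (psit (gammat w)).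

Definition elt_Ut (t : subvs_of Ut) : V :=
  vsval (Mt t) + vsval (psi_start (Mt t)) +
  vsval (M (alpha t) - alpha (Mt t)
         - 2^-1 *: psit (psi_start (Mt t)) - etat (Mt t)).

(* The element of the stabilizer of U with coordinates (M, gamma, psi, eta):
   it is given on the three summands of V = U + Wt + Ut by the maps above. *)
Definition parabolic_elt : 'End(V) :=
  linfun (fun v : V =>
    elt_U (vsproj U (daddv_pi U (Wt + Ut) v)) +
    elt_Wt (vsproj Wt (daddv_pi Wt (U + Ut) v)) +
    elt_Ut (vsproj Ut (daddv_pi Ut (U + Wt) v))).

End Element.

Definition unipotent_elt
    (x : 'Hom(W, subvs_of U) * 'Hom(dual (subvs_of U), subvs_of U)) :
    'End(V) :=
  parabolic_elt \1%VF \1%VF x.1 x.2.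

(* The image of a set G of elements of the stabilizer of U in the quotient of
   the stabilizer by the anti-symmetric maps eta, in coordinates. *)
Definition bar_image (G : set 'End(V)) :
    set ('End(subvs_of U) * 'End(W) * 'Hom(W, subvs_of U)) :=
  [set x | exists2 eta, antisymmetric_map eta &
                        G (parabolic_elt x.1.1 x.1.2 x.2 eta)].

End Coordinates.

Section CoordinatesTheory.

Variables (V : vectType rat) (B : {symmetric V}) (U Ut : {vspace V}).
Variables (W : vectType rat) (BW : {symmetric W}).
Variable p : 'Hom(subvs_of (orthov B U), W).
Variable alpha : 'Hom(subvs_of Ut, subvs_of U).
Local Notation Wt := (Wt B U Ut).

Lemma parabolic_eltE M gamma psi eta (u : subvs_of U) (w : subvs_of Wt)
    (t : subvs_of Ut) :
  directv (U + Wt + Ut) ->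
  parabolic_elt BW p alpha M gamma psi eta (vsval u + vsval w + vsval t) =
  elt_U M u + elt_Wt p gamma psi w + elt_Ut BW p alpha M psi eta t.
Proof.
move=> dir.
have proj (X Y : {vspace V}) (x : subvs_of X) y : (X :&: Y = 0)%VS -> y \in Y ->
    vsproj X (daddv_pi X Y (vsval x + y)) = x.
  move=> XY0 yY; apply: val_inj; rewrite /= vsprojK ?memv_pi // linearD /=.
  have := daddv_pi_add XY0 (subvP (addvSr X Y) _ yY).
  rewrite [daddv_pi Y X y]daddv_pi_id 1?capvC // => /(canRL (addrK _)).
  by rewrite subrr => ->; rewrite addr0 daddv_pi_id ?subvsP.
move/directvP: dir => /= dir.
have le : (\dim (U + Wt + Ut) <= \dim (U + Wt) + \dim Ut)%N by apply: dimv_add_leqif.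
have le' : (\dim (U + Wt) <= \dim U + \dim Wt)%N by apply: dimv_add_leqif.
have W0 (X Y : {vspace V}) : (\dim X + \dim Y <= \dim (X + Y))%N -> (X :&: Y = 0)%VS.
  rewrite -dimv_sum_cap -[X in (_ <= X)%N]addn0 leq_add2l leqn0 dimv_eq0.
  by move/eqP.
have H1 : (U :&: (Wt + Ut) = 0)%VS.
  apply: W0; rewrite addvA dir -addnA leq_add2l; apply: dimv_add_leqif.
have H2 : (Wt :&: (U + Ut) = 0)%VS.
  apply: W0; rewrite addvA [(Wt + U)%VS]addvC dir [(\dim U + _)%N]addnC -addnA.
  by rewrite leq_add2l; apply: dimv_add_leqif.
have H3 : (Ut :&: (U + Wt) = 0)%VS.
  by apply: W0; rewrite [(Ut + _)%VS]addvC dir addnC leq_add2r; apply: dimv_add_leqif.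
pose f v := elt_U M (vsproj U (daddv_pi U (Wt + Ut) v)) +
    elt_Wt p gamma psi (vsproj Wt (daddv_pi Wt (U + Ut) v)) +
    elt_Ut BW p alpha M psi eta (vsproj Ut (daddv_pi Ut (U + Wt) v)).
have linV (X : {vspace V}) a (x y : subvs_of X) :
    vsval (a *: x + y) = a *: vsval x + vsval y by [].
have lU : linear (elt_U M).
  by move=> a x y; rewrite /elt_U (linearP M) linV.
have lW : linear (elt_Wt p gamma psi : subvs_of Wt -> V).
  move=> a x y; rewrite /elt_Wt; cbv zeta.
  move: (_ \o gamma \o _)%VF (psi \o _)%VF => g h.
  by rewrite (linearP g) (linearP h) !linV scalerBr opprD addrACA.
have lT : linear (elt_Ut BW p alpha M psi eta : subvs_of Ut -> V).
  move=> a x y; rewrite /elt_Ut; cbv zeta.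
  move: (_ \o (dual_map M)^-1 \o _)%VF (psi \o _)%VF (eta \o _)%VF => g h e.
  move: (_ \o adjoint BW psi \o _)%VF => k.
  rewrite (linearP alpha) (linearP M) !(linearP g) (linearP alpha) !(linearP k).
  rewrite (linearP h) (linearP e) !linV 2![in RHS]scalerDr.
  rewrite [RHS]addrACA; congr (_ + _); first by rewrite [RHS]addrACA.
  rewrite -[RHS]linV; congr (vsval _); rewrite !scalerBr !scalerDr !opprD.
  rewrite !scalerA [2^-1 * a]mulrC.
  by rewrite [in RHS]addrACA; congr (_ + _); rewrite [in RHS]addrACA; congr (_ + _); rewrite [in RHS]addrACA.
have flin : linear f.
  move=> a x y; rewrite /f !(linearP (daddv_pi _ _)) !(linearP (vsproj _)).
  by rewrite lU lW lT 2![in RHS]scalerDr [RHS]addrACA; congr (_ + _); rewrite [RHS]addrACA.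
pose fL := GRing.isSemilinear.Build _ _ _ _ f (GRing.semilinear_linear flin).
pose F : {linear V -> V} := HB.pack f fL.
have -> : parabolic_elt BW p alpha M gamma psi eta = linfun F by [].
rewrite lfunE /= /f -[in X in elt_U _ X]addrA proj ?memv_add ?subvsP //.
rewrite [in X in elt_Wt _ _ _ X]addrAC [in X in elt_Wt _ _ _ X]addrC.
by rewrite [in X in elt_Ut _ _ _ _ _ _ X]addrC !proj ?memv_add ?subvsP.
Qed.

End CoordinatesTheory.

(* J and J' are lattices in Y and X. *)
Definition integral_Heisenberg (X Y : vectType rat) (B : {symmetric X})
    (J' : set X) (J : set Y) : set ('Hom(X, Y) * 'Hom(dual Y, Y)) :=
  [set x | [/\ Hom_lattice J' J x.1,
               antisymmetric_map x.2,
               Hom_lattice (Zdual J) (half_lattice J) x.2 &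
               Hom_lattice (Zdual J) J
                 (2^-1 *: (x.1 \o adjoint B x.1)%VF + x.2)]].

(* Main.v *)
(** Identify V with U + W + U^* through the complement, so that an element
    of the stabilizer of U acts by an explicit block formula. Unimodularity
    of the pairing gives L^* = (U^perp n L^* ) + It, and L^** = L then
    yields that I is the dual of It, that U^perp n L = I + Lambda, and that
    Lambda^** = Lambda. Acting trivially on L^*/L can thus be tested on the
    two summands of L^*, which gives (1).

    For (2), an integral section of L -> U^* gives a linear map u : W -> U
    such that w + u(w) lies in L^* for all w in Lambda^*, and the cocycle is
    M |-> (M - 1) u. Conversely, given (M, gamma, psi) as in (2), the
    element with eta = 0 differs from one preserving L by a map F : U^* -> U
    such that s(F s) is an integer for all s in I^*, because L is even;
    hence F - eta is integral for some anti-symmetric eta.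

    As for identity components, unipotent elements are joined to 1 by
    polynomial paths, SL(U) is generated by the 1 + N with N^2 = 0, and O(W)
    embeds continuously in the stabilizer of U; in the other direction M and
    gamma depend continuously on the element of the real stabilizer, so that
    det M > 0 and gamma stays in the identity component. *)

From HB Require Import structures.
Require Import Defs.
From mathcomp Require Import all_boot all_order all_algebra.
From mathcomp Require Import all_classical all_reals all_analysis.
From mathcomp Require Import sesquilinear.
From mathcomp Require Import ring lra.

Set Implicit Arguments.
Unset Strict Implicit.
Unset Printing Implicit Defensive.

Import Order.TTheory GRing.Theory Num.Theory.
Import numFieldNormedType.Exports.
Import passmx.

Local Open Scope classical_set_scope.
Local Open Scope ring_scope.

(** * Identity components of matrix groups *)

Section MatrixContinuity.
Variable R : realType.

(** Two features shape the argument. The complement [Ut] need not be isotropic; and although the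
    lift of [Lam] to [Wt] lies in L, the lift of its dual need not lie in L^*. A vector w of that
    dual becomes integral only after some u(w) in U is added, and u is read off from an integral
    section of L over its image in U^*. An element of Gamma_L moves w + u(w) by a vector whose
    U-component is (M - 1)u(w) - psi(gamma w). This must lie in I, which forces the class of psi and
    is the origin of the cocycle. Conversely, eta is the only freedom left once M, gamma and psi are
    given. Being antisymmetric, it cannot repair the diagonal values s(F s), so their integrality
    has to come from the evenness of L and not merely from its integrality. Connectedness concerns
    real matrices, while the elements are rational. Bilinear identities are therefore checked on
    rational vectors and transported to matrices; only the paths leave the rational points. *)

Lemma continuous_mx (T : topologicalType) m n (f : T -> 'M[R]_(m, n)) :
  (forall i j, continuous (fun x => f x i j)) -> continuous f.
Proof.
move=> fc x A [P fxP sPA].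
have : \forall y \near x, forall ij : 'I_m * 'I_n,
    P ij.1 ij.2 (f y ij.1 ij.2).
  by apply: filter_forall => ij; apply: fc; exact: fxP.
by apply: filterS => y Py; apply: sPA => i j; exact: (Py (i, j)).
Qed.

Lemma continuous_entry (T : topologicalType) m n (f : T -> 'M[R]_(m, n)) i j :
  continuous f -> continuous (fun x => f x i j).
Proof.
move=> fc x; apply: (@continuous_comp _ _ _ f (fun M : 'M[R]_(m, n) => M i j)).
  exact: fc.
exact: coord_continuous.
Qed.

Lemma continuous_mulmx (T : topologicalType) m n p (f : T -> 'M[R]_(m, n))
    (g : T -> 'M[R]_(n, p)) :
  continuous f -> continuous g -> continuous (fun x => f x *m g x).
Proof.
move=> fc gc; apply: continuous_mx => i j.
under eq_fun do rewrite mxE.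
apply: continuous_big => [|k _].
  exact: add_continuous.
by move=> x; apply: cvgM; exact: continuous_entry.
Qed.

Lemma continuous_addmx (T : topologicalType) m n (f g : T -> 'M[R]_(m, n)) :
  continuous f -> continuous g -> continuous (fun x => f x + g x).
Proof.
move=> fc gc; apply: continuous_mx => i j x.
by under eq_fun do rewrite mxE; apply: cvgD; exact: continuous_entry.
Qed.

Lemma continuous_det (T : topologicalType) n (f : T -> 'M[R]_n) :
  continuous f -> continuous (fun x => \det (f x)).
Proof.
move=> fc; rewrite /determinant.
apply: continuous_big => [|s _].
  exact: add_continuous.
move=> x; apply: cvgM; first exact: cvg_cst.
move: x; apply: continuous_big => [|i _].
  exact: mul_continuous.
exact: continuous_entry.
Qed.

Lemma connected_component_image (T S : topologicalType) (A : set T) (B : set S)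
    (f : T -> S) (x y : T) :
  continuous f -> f @` A `<=` B -> connected_component A x y ->
  connected_component B (f x) (f y).
Proof.
move=> fc fAB [C [Cx CA Cc] Cy]; exists (f @` C); last by exists y.
split; first by exists x.
  by move=> _ [z Cz <-]; apply: fAB; exists z => //; exact: CA.
by apply: connected_continuous_connected => //; exact: continuous_subspaceT.
Qed.

(** Left translation by [A] carries the component of 1 into the component of [A], which is the
    component of 1 again. *)
Lemma connected_component_mulmx n (G : set 'M[R]_n) (A B : 'M[R]_n) :
  (forall A B, G A -> G B -> G (A *m B)) ->
  connected_component G 1%:M A -> connected_component G 1%:M B ->
  connected_component G 1%:M (A *m B).
Proof.
move=> Gmul GA GB; apply: (connected_component_trans GA).
have {1}-> : A = A *m 1%:M by rewrite mulmx1.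
apply: (@connected_component_image _ _ G G (mulmx A)) => //.
  by apply: continuous_mulmx; [exact: cst_continuous|move=> x; exact: cvg_id].
by move=> _ [C GC <-]; apply: Gmul => //; exact: (connected_component_sub GA).
Qed.

Lemma connected_gt0 (S : set R) (x y : R) :
  connected S -> S x -> S y -> ~ S 0 -> 0 < x -> 0 < y.
Proof.
move=> /connected_intervalP Si Sx Sy S0 x0; rewrite ltNge; apply/negP => y0.
by apply: S0; apply: (Si _ _ Sy Sx); rewrite y0 ltW.
Qed.

End MatrixContinuity.

(** * Polynomial paths through unipotent matrices *)

Lemma polyP_nat (F : numDomainType) (p : {poly F}) :
  (forall n : nat, p.[n%:R] = 0) -> p = 0.
Proof.
move=> p0; apply/eqP/negPn/negP => pn0.
have := @max_poly_roots F p [seq n%:R | n <- iota 0 (size p)] pn0.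
rewrite size_map size_iota ltnn => H; apply/negP: isT; rewrite -H //.
  by apply/allP => _ /mapP[n _ ->]; apply/rootP.
by rewrite map_inj_uniq ?iota_uniq // => a b /eqP; rewrite eqr_nat => /eqP.
Qed.

Section UnipotentPath.
Variables (R : realType) (n : nat).

(* (1 + N)^t = \sum_k 'C(t, k) N^k for N^3 = 0: a polynomial in t, so that an
   algebraic identity valid at all naturals is valid at all reals. *)
Definition unipotent_path (N : 'M[R]_n) (t : R) : 'M[R]_n :=
  1%:M + t *: N + (t * (t - 1) / 2) *: (N *m N).

(** Pascal's rule for 1, t and t(t - 1)/2; the next binomial coefficient would multiply the cube of
    [N]. *)
Lemma unipotent_pathD1 N t : N *m N *m N = 0 ->
  unipotent_path N t *m (1%:M + N) = unipotent_path N (t + 1).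
Proof.
move=> N3; rewrite /unipotent_path mulmxDr mulmx1 !mulmxDl mul1mx.
rewrite -!scalemxAl N3 scaler0 addr0.
apply/matrixP => i j; by rewrite !mxE; field.
Qed.

Lemma unipotent_path_invariant (G N : 'M[R]_n) t : N *m N *m N = 0 ->
  (1%:M + N) *m G *m (1%:M + N)^T = G ->
  unipotent_path N t *m G *m (unipotent_path N t)^T = G.
Proof.
move=> N3 NG.
have nat_path (k : nat) :
    unipotent_path N k%:R *m G *m (unipotent_path N k%:R)^T = G.
  elim: k => [|k IH].
    by rewrite /unipotent_path !(scale0r, mul0r) !addr0 trmx1 mulmx1 mul1mx.
  rewrite -natr1 -unipotent_pathD1 // trmx_mul !mulmxA.
  by rewrite -(mulmxA _ _ G) -(mulmxA _ _ (1%:M + N)^T) NG IH.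
pose c (M : 'M[R]_n) : 'M[{poly R}]_n := map_mx polyC M.
(* [P] is the path with t replaced by an indeterminate, so the defect of invariance becomes a matrix
   of polynomials. *)
pose P : 'M[{poly R}]_n :=
  c 1%:M + 'X *: c N + ('X * ('X - 1) * (2^-1)%:P) *: c (N *m N).
have evP s : map_mx (horner_eval s) P = unipotent_path N s.
  apply/matrixP => i j.
  by rewrite !mxE /horner_eval !hornerE.
have evc s M : map_mx (horner_eval s) (c M) = M.
  by apply/matrixP => i j; rewrite !mxE /horner_eval hornerC.
have ev s : map_mx (horner_eval s) (P *m c G *m P^T - c G) =
    unipotent_path N s *m G *m (unipotent_path N s)^T - G.
  by rewrite map_mxD map_mxN !map_mxM -map_trmx !evP !evc.
have P0 : P *m c G *m P^T - c G = 0.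
  apply/matrixP => i j; rewrite [RHS]mxE; apply: polyP_nat => k.
  have /matrixP/(_ i j) := ev k%:R.
  by rewrite nat_path subrr mxE [RHS]mxE.
by apply/eqP; rewrite -subr_eq0 -ev P0 map_mx0.
Qed.

Lemma unipotent_path_continuous N : continuous (unipotent_path N).
Proof.
apply: continuous_mx => i j x; rewrite /unipotent_path.
under eq_fun do rewrite !mxE.
apply: cvgD; first apply: cvgD; first exact: cvg_cst.
  by apply: cvgM; [exact: cvg_id|exact: cvg_cst].
apply: cvgM; last exact: cvg_cst.
apply: cvgM; last exact: cvg_cst.
apply: cvgM; first exact: cvg_id.
by apply: cvgD; [exact: cvg_id|exact: cvg_cst].
Qed.

Lemma unipotent_component (N : 'M[R]_n) (S : set 'M[R]_n) :
  N *m N *m N = 0 -> (forall t, S (unipotent_path N t)) ->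
  connected_component S 1%:M (1%:M + N).
Proof.
move=> N3 Spath.
have -> : 1%:M = unipotent_path N 0.
  by rewrite /unipotent_path !(scale0r, mul0r) !addr0.
have -> : unipotent_path N 0 + N = unipotent_path N 1.
  by rewrite /unipotent_path !(scale0r, mul0r, scale1r, subrr, mulr0) !addr0.
apply: (@connected_component_image _ _ [set: R] S (unipotent_path N)).
- exact: unipotent_path_continuous.
- by move=> _ [t _ <-].
- rewrite connected_component_id //.
  apply/connected_intervalP => a b _ _ x _; exact: I.
Qed.

End UnipotentPath.

(** * Generation of the special linear group by square-zero unipotents *)

Section SpecialLinear.
Variable F : fieldType.

Lemma det_transvection n (i j : 'I_n) (c : F) : i != j ->
  \det (1%:M + c *: delta_mx i j) = 1.
Proof.
move=> ij; wlog ji : i j ij / (j < i)%N.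
  move=> det1; have [ji|lij|/val_inj e] := ltngtP j i.
  - exact: det1.
  - rewrite -det_tr linearD linearZ /= trmx1 trmx_delta det1 // eq_sym //.
  - by rewrite e eqxx in ij.
rewrite det_trig; last first.
  apply/is_trig_mxP => k l kl; rewrite !mxE.
  rewrite [k == l]negbTE ?neq_ltn ?kl // add0r.
  have -> : (k == i) && (l == j) = false; last by rewrite mulr0.
  by apply/negP => /andP[/eqP e /eqP e']; move: kl; rewrite e e' ltnNge ltnW.
rewrite big1 // => k _; rewrite !mxE eqxx.
have -> : (k == i) && (k == j) = false; last by rewrite mulr0 addr0.
by apply/negP => /andP[/eqP -> /eqP e]; rewrite e eqxx in ij.
Qed.

(** A multiple of a row k > 0 with nonzero first entry, added to row 0, makes the corner 1. If the
    first column vanishes below the corner, then the corner is nonzero and row 0 is first added to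
    row 1; hence two factors. *)
Lemma transvection_top_left n (A : 'M[F]_n.+2) : A \in unitmx ->
  exists N1 N2 : 'M[F]_n.+2, [/\ N1 *m N1 = 0, N2 *m N2 = 0,
    \det (1%:M + N1) = 1, \det (1%:M + N2) = 1 &
    ((1%:M + N1) *m ((1%:M + N2) *m A)) 0 0 = 1].
Proof.
move=> uA.
have one (k : 'I_n.+2) (B : 'M[F]_n.+2) : k != 0 -> B k 0 != 0 ->
    exists N : 'M[F]_n.+2, [/\ N *m N = 0, \det (1%:M + N) = 1 &
      ((1%:M + N) *m B) 0 0 = 1].
  move=> k0 Bk; exists (((1 - B 0 0) / B k 0) *: delta_mx 0 k); split.
  - by rewrite -scalemxAl -scalemxAr mul_delta_mx_0 // !scaler0.
  - by rewrite det_transvection // eq_sym.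
  - rewrite mulmxDl mul1mx -scalemxAl !mxE (bigD1 k) //= !mxE !eqxx mul1r.
    rewrite big1 ?addr0 ?divfK 1?addrC ?subrK // => i ik.
    by rewrite !mxE (negPf ik) andbF mul0r.
have [k /andP[k0 Ak]|nok] := pickP (fun k => (k != 0) && (A k 0 != 0)).
  have [N [N2 dN NA]] := one k A k0 Ak.
  by exists N, 0; rewrite mulmx0 addr0 mul1mx det1.
have A0 k : k != 0 -> A k 0 = 0.
  by move=> k0; apply/eqP/negPn/negP => Ak; have := nok k; rewrite k0 Ak.
have A00 : A 0 0 != 0.
  apply/negP => /eqP A00; have : row 0 A^T = 0.
    apply/rowP => k; rewrite !mxE; case: (eqVneq k 0) => [->//|]; exact: A0.
  move/(congr1 (mulmx^~ (invmx A^T))); rewrite -row_mul mulmxV ?unitmx_tr //.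
  rewrite mul0mx => /rowP/(_ 0); rewrite !mxE eqxx => /eqP.
  by rewrite oner_eq0.
pose k : 'I_n.+2 := lift 0 0.
have k0 : k != 0 by [].
pose N2 : 'M[F]_n.+2 := delta_mx k 0.
have [|N1 [N10 dN1 N1A]] := one k ((1%:M + N2) *m A) k0.
  rewrite mulmxDl mul1mx mxE A0 // add0r mxE (bigD1 0) //= mxE !eqxx mul1r big1.
    by rewrite addr0.
  by move=> i i0; rewrite mxE (negPf i0) andbF mul0r.
exists N1, N2; split=> //; first by rewrite mul_delta_mx_0 // eq_sym.
by rewrite -[N2]scale1r det_transvection.
Qed.

(** Induction on the size. Once the corner is 1, block elimination leaves a matrix of determinant 1
    of the size below; for size at most 1 the matrix is the identity. *)
Lemma sl_square_zero_ind n (P : 'M[F]_n -> Prop) :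
  (forall N, N *m N = 0 -> P (1%:M + N)) ->
  (forall A B, P A -> P B -> P (A *m B)) ->
  forall A, \det A = 1 -> P A.
Proof.
elim: n P => [|[_ P PN PM A detA|n IH P PN PM A detA]].
- move=> P PN PM A detA.
  have -> : A = 1%:M + 0 by apply/matrixP => -[].
  by apply: PN; rewrite mulmx0.
- have -> : A = 1%:M + 0.
    by apply/matrixP => i j; rewrite !ord1 addr0 !mxE -det_mx11.
  by apply: PN; rewrite mulmx0.
(* [1 - N] inverts [1 + N], so multiplication by a generator can be undone. *)
have Pcancel N B : N *m N = 0 -> P ((1%:M + N) *m B) -> P B.
  move=> N0 PB; have -> : B = (1%:M + - N) *m ((1%:M + N) *m B).
    rewrite mulmxA mulmxDl mul1mx mulmxDr mulmx1 mulNmx N0 subr0.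
    by rewrite addrK mul1mx.
  by apply: PM => //; apply: PN; rewrite mulNmx mulmxN opprK.
have uA : A \in unitmx by rewrite unitmxE detA unitr1.
have [N1 [N2 [N10 N20 dN1 dN2 NA]]] := transvection_top_left uA.
apply: (Pcancel N2) => //; apply: (Pcancel N1) => //.
have {detA} : \det ((1%:M + N1) *m ((1%:M + N2) *m A)) = 1.
  by rewrite !det_mulmx dN1 dN2 detA !mul1r.
move: (_ *m _) NA => {uA}A A00 detA.
pose A' : 'M[F]_(1 + n.+1) := A.
pose c := dlsubmx A'; pose r := ursubmx A'; pose D := drsubmx A'.
have Adec : A = block_mx 1%:M r c D.
  have e : ulsubmx A' = 1%:M.
    apply/matrixP => i j; rewrite !ord1 !mxE -[RHS]A00.
    by congr (A _ _); apply: val_inj.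
  by rewrite -e; exact: esym (submxK A').
have PN' : forall X : 'M[F]_(1 + n.+1), X *m X = 0 -> P (1%:M + X) := PN.
have one := @scalar_mx_block F 1 n.+1 1.
(* The outer factors are square-zero perturbations of 1; the middle one contains the Schur
   complement, to which the induction hypothesis applies. *)
have AE : block_mx 1%:M r c D =
    (1%:M + block_mx 0 0 c 0) *m block_mx 1%:M 0 0 (D - c *m r) *m
      (1%:M + block_mx 0 r 0 0).
  rewrite one !add_block_mx !addr0 !add0r.
  rewrite !mulmx_block !(mulmx0, mul0mx, mulmx1, mul1mx, addr0, add0r).
  by rewrite addrC subrK.
rewrite Adec AE; apply: (PM); first apply: (PM).
- by apply: PN'; rewrite mulmx_block !(mulmx0, mul0mx, addr0) block_mx0.
- pose Q (M : 'M[F]_n.+1) := P (block_mx 1%:M 0 0 M : 'M[F]_(1 + n.+1)).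
  apply: (IH Q).
  + move=> N N0; rewrite /Q.
    have -> : block_mx 1%:M 0 0 (1%:M + N) =
        1%:M + block_mx 0 0 0 N :> 'M[F]_(1 + n.+1).
      by rewrite one add_block_mx !addr0.
    by apply: PN'; rewrite mulmx_block N0 !(mulmx0, mul0mx, addr0) block_mx0.
  + move=> B C QB QC; rewrite /Q.
    have -> : block_mx 1%:M 0 0 (B *m C) =
        block_mx 1%:M 0 0 B *m block_mx 1%:M 0 0 C :> 'M[F]_(1 + n.+1).
      by rewrite mulmx_block !(mulmx0, mul0mx, addr0, add0r, mulmx1).
    exact: PM.
  + have <- : \det (block_mx 1%:M r c D) = \det (D - c *m r).
      rewrite AE one !add_block_mx !addr0 !add0r.
      by rewrite !det_mulmx !(det_ublock, det_lblock) !det1 !(mul1r, mulr1).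
    by rewrite -[RHS]detA; congr (\det _); rewrite Adec.
- by apply: PN'; rewrite mulmx_block !(mulmx0, mul0mx, addr0) block_mx0.
Qed.
End SpecialLinear.

(** * Lattices and duality *)

Section Duality.
Variable X : vectType rat.

Lemma dualP (f g : dual X) : (forall x, f x = g x) -> f = g.
Proof. by move=> fg; apply/lfunP. Qed.

Lemma dualZ (f : dual X) a x : f (a *: x) = a * f x.
Proof. by rewrite linearZ. Qed.

Lemma dualD (f : dual X) x y : f (x + y) = f x + f y.
Proof. by rewrite linearD. Qed.

Lemma dualN (f : dual X) x : f (- x) = - f x.
Proof. by rewrite linearN. Qed.

Definition dualE := (dualD, dualN, dualZ).

Definition dual_vbasis (i : 'I_(\dim {:X})) : dual X :=
  linfun (coord (vbasis {:X}) i : X -> rat^o).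

Lemma dual_vbasis_sum (f : dual X) :
  f = \sum_(i < \dim {:X}) f (vbasis {:X})`_i *: dual_vbasis i.
Proof.
apply: dualP => x; rewrite sum_lfunE.
rewrite {1}(coord_basis (vbasisP fullv) (memvf x)) linear_sum.
apply: eq_bigr => i _.
by rewrite scale_lfunE lfunE linearZ /=; exact: mulrC.
Qed.

(** Reflexivity in finite dimension; it produces vectors of U from functionals on its dual. *)
Lemma bidual_eval (phi : 'Hom(dual X, rat^o)) :
  exists x : X, forall f : dual X, phi f = f x.
Proof.
exists (\sum_i phi (dual_vbasis i) *: (vbasis {:X})`_i) => f.
rewrite {1}(dual_vbasis_sum f) !linear_sum; apply: eq_bigr => i _.
by rewrite !linearZ /=; exact: mulrC.
Qed.

Lemma dual_separates (x : X) : (forall f : dual X, f x = 0) -> x = 0.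
Proof.
move=> x0; pose e := vbasis {:X}.
rewrite (coord_basis (vbasisP fullv) (memvf x)) big1 // => i _.
have := x0 (linfun (coord e i : X -> rat^o)); rewrite lfunE /= => ->.
by rewrite scale0r.
Qed.

End Duality.

(** * Bases of lattices *)

Section LatticeBasis.
Variable X : vectType rat.

Lemma rat_mx_common_denom m n (S : 'M[rat]_(m, n)) :
  exists2 d : int, d != 0 & exists M : 'M[int]_(m, n),
    d%:~R *: S = map_mx intr M.
Proof.
pose d : int := \prod_(i < m) \prod_(j < n) denq (S i j).
exists d.
  by apply/prodf_neq0 => i _; apply/prodf_neq0 => j _; exact: denq_neq0.
have intS i j : d%:~R * S i j \is a Num.int.
  rewrite /d (bigD1 i) //= (bigD1 j) //= !rmorphM /=.
  rewrite mulrC !mulrA -numqE -mulrA rpredM // ?rpredM ?intr_int //.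
exists (\matrix_(i, j) Num.floor (d%:~R * S i j)).
by apply/matrixP => i j; rewrite !mxE floorK.
Qed.

(** The generators [s] may be linearly dependent. With denominators cleared, their matrix has a
    Smith normal form P D Q; P is invertible over the integers, so the rows of D Q generate the same
    group, and full rank makes the first n of them a basis. *)
Lemma lattice_basis (J : set X) : is_lattice fullv J ->
  exists b : (\dim {:X}).-tuple X, basis_of fullv b /\
    forall v, J v <-> forall i, coord b i v \is a Num.int.
Proof.
move=> [m [s [sX ->]]]; set n := \dim {:X}.
pose e := vbasis {:X}; have eb : basis_of {:X} e := vbasisP _.
pose S : 'M[rat]_(m, n) := \matrix_i rVof e s`_i.
have spanE v : inIntSpan s v <-> exists a : 'rV[int]_m,
    rVof e v = map_mx intr a *m S.
  have sumE (a : 'I_m -> int) :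
      rVof e (\sum_(i < m) s`_i *~ a i) = map_mx intr (\row_i a i) *m S.
    rewrite linear_sum mulmx_sum_row; apply: eq_bigr => i _.
    by rewrite rowK !mxE scaler_int raddfMz.
  split=> [[a ->]|[a va]]; first by exists (\row_i a i); rewrite sumE.
  exists [ffun i => a 0 i]; apply: (can_inj (rVofK eb)); rewrite sumE va.
  by congr (map_mx _ _ *m _); apply/rowP => i; rewrite mxE ffunE.
have Sfull : row_full S.
  rewrite -sub1mx; apply/row_subP => i.
  rewrite rowE mulmx1 -(rVofE eb i).
  have : e`_i \in << s >>%VS by rewrite sX memvf.
  move/(@coord_span _ _ _ s) => ->; rewrite linear_sum summx_sub // => j _.
  rewrite linearZ scalemx_sub //=.
  have -> : rVof e s`_j = row j S by rewrite rowK.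
  exact: row_sub.
have [d d0 [M SM]] := rat_mx_common_denom S.
have [P uP [Q uQ [dd _ ME]]] := int_Smith_normal_form M.
pose ir k l (A : 'M[int]_(k, l)) : 'M[rat]_(k, l) := map_mx intr A.
(* The rows of [C] will be the basis; dividing by [d] restores the denominators. *)
pose C : 'M[rat]_n :=
  d%:~R^-1 *: (diag_mx (\row_j (dd`_j)%:~R) *m ir _ _ Q).
have SC : S = ir _ _ P *m pid_mx n *m C.
  have d0' : d%:~R != 0 :> rat by rewrite intr_eq0.
  rewrite -[S](scalerK d0') SM ME !map_mxM -scalemxAr; congr (_ *: _).
  rewrite !mulmxA -(mulmxA _ (pid_mx n)); congr (_ *m _ *m _).
  apply/matrixP => i j; rewrite mul_mx_diag !mxE.
  by case: eqP => [->|_]; rewrite ?ltn_ord ?mul1r ?mul0r // mulr1n.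
have uC : C \in unitmx.
  rewrite -row_full_unit -sub1mx.
  by apply: submx_trans (_ : S <= _)%MS; rewrite ?sub1mx // SC submxMl.
have nm : (n <= m)%N.
  have := Sfull; rewrite /row_full SC mxrankMfree ?row_free_unit // => /eqP <-.
  exact: rank_leq_row.
pose b : n.-tuple X := [tuple vecof e (row i C) | i < n].
have bE (i : 'I_n) : b`_i = vecof e (row i C) by rewrite -tnth_nth tnth_mktuple.
have combE (k : 'I_n -> rat) :
    rVof e (\sum_i k i *: b`_i) = (\row_i k i) *m C.
  rewrite linear_sum mulmx_sum_row; apply: eq_bigr => i _.
  by rewrite linearZ /= bE vecofK // mxE.
have bfree : free b.
  apply/freeP => k k0 i.
  have /(congr1 (mulmx^~ (invmx C))) := combE k.
  by rewrite k0 linear0 mul0mx mulmxK // => /rowP/(_ i); rewrite !mxE => <-.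
have bb : basis_of fullv b.
  by rewrite basisEfree bfree subvf size_tuple leqnn.
exists b; split=> // v; apply: (iff_trans (spanE v)).
have coordE : rVof e v = (\row_i coord b i v) *m C.
  by rewrite -combE -(coord_basis bb (memvf v)).
split=> [[a va] i|ki].
  have := va; rewrite coordE SC mulmxA => /(congr1 (mulmx^~ (invmx C))).
  rewrite !mulmxK // => /rowP/(_ i); rewrite mxE => ->.
  have -> : map_mx intr a *m (ir _ _ P *m pid_mx n) =
      map_mx intr (a *m (P *m pid_mx n)) :> 'rV[rat]_n.
    by rewrite !map_mxM map_pid_mx.
  by rewrite mxE intr_int.
(* The integral inverse of [P] turns basis coordinates, padded by zeros, back into coefficients of
   the generators. *)
exists (\row_i Num.floor (coord b i v) *m pid_mx n *m invmx P).
rewrite !map_mxM map_pid_mx SC coordE !mulmxA; congr (_ *m _).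
rewrite -(mulmxA _ _ (ir _ _ P)) -map_mxM mulVmx // map_mx1 mulmx1.
rewrite -mulmxA pid_mx_id // pid_mx_1 mulmx1.
apply/rowP => i; rewrite !mxE /=; exact: esym (floorK _).
Qed.

(** The coordinate functionals of a basis of [J] suffice as tests. *)
Lemma lattice_bidual (J : set X) (y : X) : is_lattice fullv J ->
  (forall phi : dual X, (forall x, J x -> phi x \is a Num.int) ->
     phi y \is a Num.int) -> J y.
Proof.
move=> /lattice_basis[b [bb JE]] yint; apply/JE => i.
have := yint (linfun (coord b i : X -> rat^o)); rewrite lfunE; apply => x Jx.
by rewrite lfunE; move/JE: Jx => /(_ i).
Qed.

Lemma lattice_multiple (J : set X) (x : X) : is_lattice fullv J ->
  exists2 d : int, d != 0 & J (d%:~R *: x).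
Proof.
move=> /lattice_basis[b [bb JE]].
have [d d0 [M dM]] := rat_mx_common_denom (\row_i coord b i x).
exists d => //; apply/JE => i; rewrite linearZ /=.
by have /rowP/(_ i) := dM; rewrite !mxE => ->; rewrite intr_int.
Qed.

End LatticeBasis.

Lemma lattice_image (X Y : vectType rat) (Z : {vspace X}) (J : set X)
    (f : 'Hom(X, Y)) :
  is_lattice Z J -> (f @: Z)%VS = fullv -> is_lattice fullv (f @` J).
Proof.
move=> [m [s [sZ ->]]] fZ; exists m, [tuple of map f s]; split.
  by rewrite -limg_span sZ.
apply/seteqP; split=> [_ [x [a ->] <-]|y [a ->]].
  exists a; rewrite linear_sum; apply: eq_bigr => i _.
  by rewrite raddfMz (nth_map 0) // size_tuple.
exists (\sum_(i < m) s`_i *~ a i); first by exists a.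
rewrite linear_sum; apply: eq_bigr => i _.
by rewrite raddfMz (nth_map 0) // size_tuple.
Qed.

(* The integral part F - eta has an upper triangular Gram matrix in a basis
   of J. *)
Lemma antisymmetric_integral_part (X : vectType rat) (J : set (dual X))
    (F : 'Hom(dual X, X)) : is_lattice fullv J ->
  (forall s : dual X, J s -> s (F s) \is a Num.int) ->
  exists2 eta : 'Hom(dual X, X), antisymmetric_map eta &
    forall s t : dual X, J s -> J t -> t (F s - eta s) \is a Num.int.
Proof.
move=> /lattice_basis[b [bb JE]] Fint.
have bJ (i : 'I_(\dim {:dual X})) : J b`_i.
  by apply/JE => j; rewrite coord_free ?(basis_free bb) //; case: eqP.
have JD s t : J s -> J t -> J (s + t).
  by move=> /JE sJ /JE tJ; apply/JE => i; rewrite linearD /= rpredD.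
(* [u] is the basis of X dual to the basis [b] of [J]. *)
have [u uE] : exists u : 'I_(\dim {:dual X}) -> X,
    forall i k : 'I_(\dim {:dual X}), (b`_i : dual X) (u k) = (i == k)%:R.
  have H k := bidual_eval (linfun (coord b k : dual X -> rat^o)).
  have [u uE] := choice H; exists u => i k.
  by rewrite -uE lfunE /= coord_free ?(basis_free bb) // eq_sym.
pose q (i j : 'I_(\dim {:dual X})) : rat := (b`_i : dual X) (F b`_j).
pose g (i j : 'I_(\dim {:dual X})) : rat := if i == j then q i i else
  if (i < j)%N then q i j + q j i else 0.
have gint i j : g i j \is a Num.int.
  rewrite /g; case: eqP => _; first exact: Fint.
  case: ltnP => // _.
  (* Polarisation: the hypothesis controls only the diagonal values s (F s). *)
  have -> : q i j + q j i = (b`_i + b`_j : dual X) (F (b`_i + b`_j))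
      - q i i - q j j.
    by rewrite /q add_lfunE !linearD /=; ring.
  by rewrite !rpredB ?Fint //; apply: JD.
have gsym i j : g i j + g j i = q i j + q j i.
  rewrite /g [j == i]eq_sym; case: eqP => [->//|/eqP ij].
  case: ltngtP => [|_|/val_inj/eqP]; rewrite ?addr0 ?add0r //.
    by rewrite addrC.
  by rewrite (negPf ij).
pose Gf (s : dual X) : X := \sum_j coord b j s *: \sum_i g i j *: u i.
have Glin : linear Gf.
  move=> a s t; rewrite /Gf scaler_sumr -big_split; apply: eq_bigr => j _.
  by rewrite linearP scalerDl scalerA.
pose GL := GRing.isSemilinear.Build _ _ _ _ Gf (GRing.semilinear_linear Glin).
pose G : {linear dual X -> X} := HB.pack Gf GL.
have GE (i : 'I_(\dim {:dual X})) s :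
    (b`_i : dual X) (linfun G s) = \sum_j coord b j s * g i j.
  rewrite lfunE /= linear_sum; apply: eq_bigr => j _.
  rewrite /= dualZ; congr (_ * _); rewrite linear_sum (bigD1 i) //=.
  rewrite dualZ uE eqxx mulr1 big1 ?addr0 // => k ki.
  by rewrite dualZ uE eq_sym (negPf ki) mulr0.
have expand (t : dual X) x :
    t x = \sum_(i < \dim {:dual X}) coord b i t * (b`_i : dual X) x.
  rewrite {1}[t](coord_basis bb) ?memvf // sum_lfunE.
  by apply: eq_bigr => i _; rewrite scale_lfunE.
exists (F - linfun G).
  have qE (i : 'I_(\dim {:dual X})) t :
      (b`_i : dual X) (F t) = \sum_j coord b j t * q i j.
    rewrite {1}[t](coord_basis bb) ?memvf // !linear_sum.
    by apply: eq_bigr => j _; rewrite !linearZ.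
  have E (s t : dual X) : s ((F - linfun G) t) =
      \sum_i \sum_j coord b i s * coord b j t * (q i j - g i j).
    rewrite expand; apply: eq_bigr => i _.
    rewrite add_lfunE opp_lfunE linearB /= qE GE -sumrB mulr_sumr.
    by apply: eq_bigr => j _; ring.
  move=> s t; rewrite !E exchange_big /= -sumrN; apply: eq_bigr => i _.
  rewrite -sumrN; apply: eq_bigr => j _.
  have := gsym i j => /eqP; rewrite addrC -subr_eq => /eqP <-; ring.
move=> s t /JE sJ /JE tJ.
rewrite add_lfunE opp_lfunE opprB addrC subrK expand rpred_sum // => i _.
by rewrite rpredM // GE rpred_sum // => j _; rewrite rpredM.
Qed.

(** * Symmetric forms, subspaces and dual maps *)

Section SymmetricForms.
Variables (X : vectType rat) (B : {symmetric X}).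

Lemma symf_sym x y : B x y = B y x. Proof. by rewrite hermC mul1r. Qed.
Lemma symfDl x y z : B (x + y) z = B x z + B y z.
Proof. by rewrite linearDl. Qed.
Lemma symfDr x y z : B z (x + y) = B z x + B z y.
Proof. by rewrite linearDr. Qed.
Lemma symfNl x y : B (- x) y = - B x y. Proof. by rewrite linearNl. Qed.
Lemma symfNr x y : B x (- y) = - B x y. Proof. by rewrite linearNr. Qed.
Lemma symfZl a x y : B (a *: x) y = a * B x y.
Proof. by rewrite linearZl_LR. Qed.
Lemma symfZr a x y : B x (a *: y) = a * B x y.
Proof. by rewrite linearZr_LR. Qed.
Lemma symf0l x : B 0 x = 0. Proof. by rewrite linear0l. Qed.
Lemma symf0r x : B x 0 = 0. Proof. by rewrite linear0r. Qed.

Definition symfE :=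
  (symfDl, symfDr, symfNl, symfNr, symfZl, symfZr, symf0l, symf0r).

Lemma nondegenerateP :
  nondegenerate B <-> (forall x, (forall y, B x y = 0) -> x = 0).
Proof.
split=> [/eqP nd x x0|nd].
  by apply/eqP; rewrite -memv0 -nd; apply/mem_orthovP => y _; exact: x0.
rewrite /nondegenerate -subv0; apply/subvP => x /mem_orthovP x0.
by rewrite memv0; apply/eqP/nd => y; rewrite x0 ?memvf.
Qed.

End SymmetricForms.

Lemma linfunE (X Y : vectType rat) (f : X -> Y) : linear f -> linfun f =1 f.
Proof.
move=> flin x.
pose fL := GRing.isSemilinear.Build _ _ _ _ f (GRing.semilinear_linear flin).
pose F : {linear X -> Y} := HB.pack f fL.
exact: (@lfunE _ _ _ F).
Qed.

Section SubvsVal.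
Variables (X : vectType rat) (Z : {vspace X}).
Implicit Types x y : subvs_of Z.

Lemma vsvalD x y : vsval (x + y) = vsval x + vsval y. Proof. by []. Qed.
Lemma vsvalN x : vsval (- x) = - vsval x. Proof. by []. Qed.
Lemma vsvalZ a x : vsval (a *: x) = a *: vsval x. Proof. by []. Qed.
Lemma vsval0 : vsval (0 : subvs_of Z) = 0. Proof. by []. Qed.

Definition vsvalE := (vsvalD, vsvalN, vsvalZ, vsval0).

End SubvsVal.

Section DualMaps.
Variables (X Y : vectType rat).

Lemma flatE (B : {symmetric X}) x y : flat B x y = B x y.
Proof.
have lin z : linear (fun y => B z y : rat^o).
  by move=> a u v; rewrite symfDr symfZr.
rewrite /flat linfunE; first by rewrite (linfunE (lin x)).
move=> a u v; apply: dualP => z.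
by rewrite add_lfunE scale_lfunE !(linfunE (lin _)) symfDl symfZl.
Qed.

Lemma dual_mapE (f : 'Hom(X, Y)) (g : dual Y) x : dual_map f g x = g (f x).
Proof.
rewrite /dual_map linfunE ?comp_lfunE // => a u v.
by apply: dualP => z; rewrite !(comp_lfunE, add_lfunE, scale_lfunE).
Qed.

Lemma flat_bij (B : {symmetric X}) : nondegenerate B ->
  cancel ((flat B)^-1)%VF (flat B).
Proof.
move=> /nondegenerateP nd f.
have ker0 : lker (flat B) == 0%VS.
  rewrite -subv0; apply/subvP => x; rewrite memv_ker memv0 => /eqP x0.
  by apply/eqP/nd => y; rewrite -flatE x0 zero_lfunE.
apply: limg_lfunVK; suff -> : limg (flat B) = fullv by exact: memvf.
apply/eqP; rewrite eqEdim subvf limg_dim_eq ?(eqP ker0) ?capv0 //.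
by rewrite !dimvf /dim /= muln1.
Qed.

End DualMaps.

Lemma adjointE (X Y : vectType rat) (B : {symmetric X}) (psi : 'Hom(X, Y))
    (f : dual Y) x : nondegenerate B -> B (adjoint B psi f) x = f (psi x).
Proof.
by move=> nd; rewrite -flatE /adjoint comp_lfunE flat_bij // dual_mapE.
Qed.

Lemma dual_map_inv (X : vectType rat) (M : 'End(X)) (f : dual X) x :
  lker M == 0%VS -> ((dual_map M)^-1)%VF f (M x) = f x.
Proof.
move=> kM; rewrite -dual_mapE limg_lfunVK //.
apply/memv_imgP; exists (f \o M^-1)%VF; first exact: memvf.
by apply: dualP => y; rewrite dual_mapE comp_lfunE lker0_lfunK.
Qed.

Lemma lker0_lfunVK_end (X : vectType rat) (M : 'End(X)) :
  lker M == 0%VS -> cancel (M^-1)%VF M.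
Proof.
move=> kM x; apply: limg_lfunVK; rewrite (_ : limg M = fullv) ?memvf //.
by apply/eqP; rewrite eqEdim subvf limg_dim_eq ?(eqP kM) ?capv0 /=.
Qed.

(** The way the inverse transpose is computed: its values on the image of [M] determine it, because
    an injective endomorphism is onto. *)
Lemma dual_map_inv_unique (X : vectType rat) (M : 'End(X)) (f g : dual X) :
  lker M == 0%VS -> (forall x, g (M x) = f x) -> g = ((dual_map M)^-1)%VF f.
Proof.
move=> kM gf; apply: dualP => x.
by rewrite -(lker0_lfunVK_end kM x) gf dual_map_inv.
Qed.

Lemma lker_id (X : vectType rat) : lker (\1%VF : 'End(X)) == 0%VS.
Proof.
rewrite -subv0; apply/subvP => x.
by rewrite memv_ker memv0 id_lfunE.
Qed.

Lemma lker0_comp (X Y Z : vectType rat) (f : 'Hom(Y, Z)) (g : 'Hom(X, Y)) :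
  lker f == 0%VS -> lker g == 0%VS -> lker (f \o g)%VF == 0%VS.
Proof.
move=> kf kg; rewrite -subv0; apply/subvP => x.
rewrite memv_ker memv0 comp_lfunE => /eqP fx.
by rewrite -(lker0_lfunK kg x) -(lker0_lfunK kf (g x)) fx !linear0.
Qed.

Lemma dual_map_inv1 (X : vectType rat) (f : dual X) :
  ((dual_map (\1%VF : 'End(X)))^-1)%VF f = f.
Proof.
by apply/esym/dual_map_inv_unique => [|x]; rewrite ?lker_id ?id_lfunE.
Qed.

Lemma id_isometry (X : vectType rat) (C : {symmetric X}) :
  isometry C C (\1%VF : 'End(X)).
Proof. by move=> x y; rewrite !id_lfunE. Qed.

Lemma antisymmetric0 (X : vectType rat) :
  antisymmetric_map (0 : 'Hom(dual X, X)).
Proof. by move=> f g; rewrite !(zero_lfunE, linear0). Qed.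

Lemma end_det_lker (X : vectType rat) (M : 'End(X)) :
  end_det M != 0 -> lker M == 0%VS.
Proof.
move=> dM; rewrite -subv0; apply/subvP => x; rewrite memv_ker memv0 => /eqP Mx.
have := @rVof_app _ _ _ (vbasis {:X}) (vbasis {:X}) (vbasisP _) M x.
set m := mxof _ _ M; rewrite Mx linear0 => /esym/(congr1 (mulmx^~ (invmx m))).
rewrite mulmxK ?unitmxE ?unitfE // mul0mx => /eqP.
by rewrite rVof_eq0 ?vbasisP.
Qed.

(** On row vectors [K] embeds the small space and [J] projects onto it, each adjoint to the other.
    The matrix acts as [g] on the image of [K] and as 1 on the kernel of [J]. With g = 1 + Q, its
    defect is Q H + H Q^T + Q H Q^T = 0 between [J] and its transpose. *)
Lemma extend_isometry_mx (F : comNzRingType) m n (G : 'M[F]_n) (H g : 'M[F]_m)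
    (J : 'M[F]_(n, m)) (K : 'M[F]_(m, n)) :
  K *m G = H *m J^T -> G *m K^T = J *m H -> K *m J = 1%:M ->
  g *m H *m g^T = H ->
  (1%:M + J *m (g - 1%:M) *m K) *m G *m (1%:M + J *m (g - 1%:M) *m K)^T = G.
Proof.
move=> KG GK KJ; have {1 2}-> : g = 1%:M + (g - 1%:M) by rewrite addrC subrK.
move: (g - 1%:M) => Q.
rewrite !linearD /= !trmx1 !(mulmxDl, mulmxDr, mul1mx, mulmx1) => /eqP.
rewrite -addrA -subr_eq0 addrAC subrr add0r => /eqP HQ.
have KJt : J^T *m K^T = 1%:M by rewrite -trmx_mul KJ trmx1.
rewrite !trmx_mul -(mulmxA _ K) KG !mulmxA GK -(mulmxA _ J^T K^T) KJt mulmx1.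
rewrite -!(mulmxA J) -!addrA -!mulmxDr -!(mulmxDl _ _ J^T) HQ.
by rewrite mul0mx mulmx0 addr0.
Qed.

(** * Real matrices of rational maps and the real stabilizer of U *)

Section RealMatrices.
Variable R : realType.

(** Rectangular version of [real_mx], with which it agrees on endomorphisms; since matrices act on
    rows, composition reverses the factors. *)
Definition realmx (X Y : vectType rat) (f : 'Hom(X, Y)) :
    'M[R]_(\dim {:X}, \dim {:Y}) :=
  map_mx ratr (mxof (vbasis {:X}) (vbasis {:Y}) f).

Lemma realmx_comp (X Y Z : vectType rat) (f : 'Hom(X, Y)) (g : 'Hom(Y, Z)) :
  realmx (g \o f)%VF = realmx f *m realmx g.
Proof.
by rewrite -map_mxM -mxof_comp //; exact: vbasisP.
Qed.

Lemma realmx1 (X : vectType rat) : realmx (\1%VF : 'End(X)) = 1%:M.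
Proof. by rewrite /realmx mxof1 ?map_mx1 // (basis_free (vbasisP _)). Qed.

Lemma realmxD (X Y : vectType rat) (f g : 'Hom(X, Y)) :
  realmx (f + g) = realmx f + realmx g.
Proof. by rewrite /realmx linearD map_mxD. Qed.

Lemma realmxN (X Y : vectType rat) (f : 'Hom(X, Y)) : realmx (- f) = - realmx f.
Proof. by rewrite /realmx linearN map_mxN. Qed.

Lemma realmx0 (X Y : vectType rat) : realmx (0 : 'Hom(X, Y)) = 0.
Proof. by rewrite /realmx linear0 map_mx0. Qed.

Lemma realmx_gram (X Y Z : vectType rat) (B : {symmetric Z}) (f : 'Hom(X, Z))
    (g : 'Hom(Y, Z)) :
  realmx f *m real_gram R B *m (realmx g)^T =
  \matrix_(i, j) ratr (B (f (vbasis {:X})`_i) (g (vbasis {:Y})`_j)).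
Proof.
apply/matrixP => i j; rewrite !mxE.
rewrite [g _](coord_basis (vbasisP fullv) (memvf _)).
rewrite linear_sumr /= rmorph_sum; apply: eq_bigr => k _.
rewrite symfZr [f _](coord_basis (vbasisP fullv) (memvf _)).
rewrite linear_sumlz /= rmorphM /= rmorph_sum mulrC !mxE /= vecof_delta.
congr (_ * _); apply: eq_bigr => l _.
by rewrite symfZl rmorphM !mxE /= vecof_delta.
Qed.

(** Turns an identity between rational forms into one between real matrices, so that orthogonality
    and adjunction are checked on rational vectors. *)
Lemma realmx_form (X Y Z T : vectType rat) (B : {symmetric Z})
    (C : {symmetric T}) (f : 'Hom(X, Z)) (g : 'Hom(Y, Z)) (h : 'Hom(X, T))
    (k : 'Hom(Y, T)) : (forall x y, B (f x) (g y) = C (h x) (k y)) ->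
  realmx f *m real_gram R B *m (realmx g)^T =
  realmx h *m real_gram R C *m (realmx k)^T.
Proof.
by move=> BC; rewrite !realmx_gram; apply/matrixP => i j; rewrite !mxE BC.
Qed.

Lemma realmx_form0 (X Y Z : vectType rat) (B : {symmetric Z})
    (f : 'Hom(X, Z)) (g : 'Hom(Y, Z)) : (forall x y, B (f x) (g y) = 0) ->
  realmx f *m real_gram R B *m (realmx g)^T = 0.
Proof.
move=> B0; rewrite realmx_gram; apply/matrixP => i j.
by rewrite !mxE B0 rmorph0.
Qed.

Lemma real_gram_tr (X : vectType rat) (B : {symmetric X}) :
  (real_gram R B)^T = real_gram R B.
Proof. by apply/matrixP => i j; rewrite !mxE symf_sym. Qed.

Lemma real_gram_unit (X : vectType rat) (B : {symmetric X}) :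
  nondegenerate B -> real_gram R B \in unitmx.
Proof.
move=> /nondegenerateP nd.
pose e := vbasis {:X}; pose n := \dim {:X}.
pose gram : 'M[rat]_n := \matrix_(i, j) B e`_i e`_j.
have -> : real_gram R B = map_mx ratr gram.
  by apply/matrixP => i j; rewrite !mxE.
rewrite map_unitmx -row_free_unit; apply: inj_row_free => v v0.
have : vecof e v = 0.
  apply: nd => y; rewrite [y](coord_basis (vbasisP fullv) (memvf _)).
  rewrite linear_sumr /= big1 // => j _; rewrite symfZr.
  have /rowP/(_ j) := v0; rewrite !mxE => vj.
  rewrite (_ : B _ _ = 0) ?mulr0 // -[RHS]vj /vecof linear_sumlz /=.
  by apply: eq_bigr => i _; rewrite symfZl !mxE.
by move=> e0; apply/eqP; rewrite -(vecof_eq0 (vbasisP _)) e0.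
Qed.

Lemma realmx_isometry (X : vectType rat) (B : {symmetric X}) (A : 'End(X)) :
  isometry B B A -> real_O B (real_mx R A).
Proof.
move=> iso; rewrite /real_O /=.
have := @realmx_form X X X X B B A A \1%VF \1%VF.
rewrite !realmx1 mul1mx trmx1 mulmx1; apply => x y.
by rewrite !id_lfunE iso.
Qed.

Section Parabolic.
Variables (V : vectType rat) (B : {symmetric V}) (U : {vspace V}).

Definition subvs_incl : 'Hom(subvs_of U, V) := linfun vsval.

Lemma subvs_inclE u : subvs_incl u = vsval u. Proof. by rewrite lfunE. Qed.

Definition subvs_proj : 'Hom(V, subvs_of U) := linfun (vsproj U).

Lemma subvs_projE v : subvs_proj v = vsproj U v. Proof. by rewrite lfunE. Qed.

(** [real_vspace] comes from the projector onto U, while the inclusion composes better with other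
    maps; each factors through the other. *)
Lemma real_vspaceE : (real_vspace R U == realmx subvs_incl)%MS.
Proof.
have bV := vbasisP {:V}; have bU := vbasisP {:subvs_of U}.
rewrite /real_vspace /realmx /msof !map_submx; apply/andP; split.
  have -> : projv U = (subvs_incl \o (linfun (vsproj U) \o projv U))%VF.
    apply/lfunP => v; rewrite !comp_lfunE subvs_inclE lfunE /=.
    by rewrite vsprojK ?memv_proj.
  by rewrite (@mxof_comp _ _ _ _ _ _ _ bU) submxMl.
have -> : subvs_incl = (projv U \o subvs_incl)%VF.
  apply/lfunP => u; rewrite !comp_lfunE subvs_inclE projv_id //.
  exact: subvsP.
by rewrite (@mxof_comp _ _ _ _ _ _ _ bV) submxMl.
Qed.

Lemma real_parabolicE (A : 'M[R]_(\dim {:V})) : real_parabolic B U A <->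
  real_O B A /\ (realmx subvs_incl *m A == realmx subvs_incl)%MS.
Proof.
have /eqmxP e := real_vspaceE.
by rewrite /real_parabolic /= !(eqmxMr A e, e).
Qed.

Lemma real_parabolicM (A C : 'M[R]_(\dim {:V})) :
  real_parabolic B U A -> real_parabolic B U C -> real_parabolic B U (A *m C).
Proof.
move=> [AO /eqmxP AU] [CO /eqmxP CU]; split.
  by rewrite /real_O /= trmx_mul !mulmxA -(mulmxA A) -(mulmxA A) CO.
by apply/eqmxP; rewrite mulmxA; exact: eqmx_trans (eqmxMr C AU) CU.
Qed.

Lemma real_O_unit (A : 'M[R]_(\dim {:V})) :
  nondegenerate B -> real_O B A -> A \in unitmx.
Proof.
move=> /real_gram_unit uG AO; have := congr1 determinant AO.
rewrite !det_mulmx det_tr !unitmxE !unitfE in uG * => dA.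
apply/negP => /eqP d0; move: uG; rewrite -dA d0 !mul0r.
by rewrite eqxx.
Qed.

(** An element of the orthogonal group is invertible, so the inclusion of row spaces is an equality
    by rank. *)
Lemma real_parabolic_stable (A : 'M[R]_(\dim {:V})) :
  nondegenerate B -> real_O B A ->
  (realmx subvs_incl *m A <= realmx subvs_incl)%MS -> real_parabolic B U A.
Proof.
move=> nd AO AU; apply/real_parabolicE; split=> //.
rewrite -(mxrank_leqif_eq AU) mxrankMfree // row_free_unit.
exact: real_O_unit AO.
Qed.

Lemma real_parabolic0_unipotent (A : 'End(V)) (N := (A - \1)%VF) :
  nondegenerate B -> isometry B B A ->
  (forall u, u \in U -> A u \in U) -> (N \o N \o N)%VF = 0 ->
  real_parabolic0 B U (real_mx R A).
Proof.
move=> nd iso AU N3.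
have -> : real_mx R A = 1%:M + realmx N.
  by rewrite realmxD realmxN realmx1 addrC subrK.
apply: unipotent_component.
  by rewrite -!realmx_comp comp_lfunA N3 realmx0.
move=> t; apply: real_parabolic_stable => //.
  rewrite /real_O /=; apply: unipotent_path_invariant.
    by rewrite -!realmx_comp comp_lfunA N3 realmx0.
  have -> : 1%:M + realmx N = real_mx R A.
    by rewrite realmxD realmxN realmx1 addrC subrK.
  exact: realmx_isometry.
have NU : (realmx subvs_incl *m realmx N <= realmx subvs_incl)%MS.
  rewrite -realmx_comp.
  have -> : (N \o subvs_incl)%VF =
      (subvs_incl \o (subvs_proj \o (N \o subvs_incl)))%VF.
    apply/lfunP => u; rewrite !comp_lfunE !subvs_inclE subvs_projE.
    rewrite vsprojK // add_lfunE opp_lfunE id_lfunE rpredB ?AU ?subvsP //.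
  by rewrite realmx_comp submxMl.
rewrite /unipotent_path !mulmxDr mulmx1 -!scalemxAr !addmx_sub ?scalemx_sub //.
by rewrite mulmxA (submx_trans (submxMr _ NU)).
Qed.

Lemma real_parabolic0M (A C : 'M[R]_(\dim {:V})) :
  real_parabolic0 B U A -> real_parabolic0 B U C ->
  real_parabolic0 B U (A *m C).
Proof. apply: connected_component_mulmx; exact: real_parabolicM. Qed.

Lemma real_parabolic0_SOplus (A : 'M[R]_(\dim {:V})) :
  real_parabolic0 B U A -> real_SOplus B A.
Proof.
move=> [C [C1 CP Cc] CA]; exists C => //; split=> // x /CP[].
by [].
Qed.

Lemma real_parabolic0_det_gt0 (A : 'End(V)) (M : 'End(subvs_of U)) :
  real_parabolic0 B U (real_mx R A) ->
  (forall u, A (vsval u) = vsval (M u)) -> 0 < end_det M.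
Proof.
move=> PA AM.
pose f (C : 'M[R]_(\dim {:V})) :=
  \det (realmx subvs_incl *m C *m realmx subvs_proj).
have projK : realmx subvs_incl *m realmx subvs_proj = 1%:M.
  rewrite -realmx_comp -realmx1; congr realmx; apply/lfunP => u.
  by rewrite comp_lfunE subvs_inclE subvs_projE vsvalK id_lfunE.
have fM : f (real_mx R A) = ratr (end_det M).
  rewrite /f -!realmx_comp -det_map_mx; congr (\det (map_mx _ (mxof _ _ _))).
  apply/lfunP => u; rewrite !comp_lfunE subvs_inclE AM.
  by rewrite subvs_projE vsvalK.
have fc : continuous f.
  apply: continuous_det; apply: continuous_mulmx; last exact: cst_continuous.
  apply: continuous_mulmx; first exact: cst_continuous.
  by move=> x; exact: cvg_id.
have f0 (C : 'M[R]_(\dim {:V})) : real_parabolic B U C -> f C <> 0.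
  (* U is contained in its image under [C], which gives the compression of [C] to U a left inverse
     [E]. *)
  move=> /real_parabolicE[_ /andP[/submxP[D CD] /submxP[E EC]]].
  have : E *m (realmx subvs_incl *m C *m realmx subvs_proj) = 1%:M.
    by rewrite !mulmxA -(mulmxA E) -EC.
  move=> /mulmx1_unit[_]; rewrite unitmxE unitfE => H H0.
  by rewrite -/(f C) H0 eqxx in H.
rewrite -(ltr0q R) -fM.
have [C [C1 CP Cc] CA] := PA.
apply: (@connected_gt0 R (f @` C) (f 1%:M)).
- by apply: connected_continuous_connected => //; exact: continuous_subspaceT.
- by exists 1%:M.
- by exists (real_mx R A).
- by move=> [x Cx]; apply: f0; exact: CP.
- by rewrite /f mulmx1 projK det1.
Qed.

End Parabolic.

End RealMatrices.

(** * Lattice automorphisms and determinants *)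

Section IntegralLattices.
Variables (X : vectType rat).

Lemma is_latticeB (Z : {vspace X}) (J : set X) x y :
  is_lattice Z J -> J x -> J y -> J (x - y).
Proof.
move=> [m [s [_ ->]]] [a ->] [c ->]; exists (a - c).
rewrite -sumrB; apply: eq_bigr => i _.
by rewrite -mulrzBr !ffunE.
Qed.

Lemma is_lattice0 (Z : {vspace X}) (J : set X) : is_lattice Z J -> J 0.
Proof.
move=> [m [s [_ ->]]]; exists [ffun=> 0].
by rewrite big1 // => i _; rewrite ffunE mulr0z.
Qed.

Lemma is_lattice_sub (Z : {vspace X}) (J : set X) x :
  is_lattice Z J -> J x -> x \in Z.
Proof.
move=> [m [s [<- ->]]] [a ->]; rewrite rpred_sum // => i _.
by rewrite rpredMz // memv_span // mem_nth // size_tuple.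
Qed.

Lemma is_lattice_multiple (Z : {vspace X}) (J : set X) x :
  is_lattice Z J -> x \in Z -> exists2 d : int, d != 0 & J (d%:~R *: x).
Proof.
move=> [m [s [<- ->]]] /coord_span xs.
have [d d0 [M dM]] := rat_mx_common_denom (\row_i coord s i x).
exists d => //; exists [ffun i => M 0 i].
rewrite {1}xs scaler_sumr; apply: eq_bigr => i _; rewrite scalerA ffunE.
have /rowP/(_ i) := dM; rewrite !mxE => ->.
by rewrite scaler_int.
Qed.

(** Serves to show that I, given only as the intersection of U and L, is a lattice: it is the
    predual of I^*. The generators are the basis dual to one of [J]. *)
Lemma predual_lattice (J : set (dual X)) : is_lattice fullv J ->
  is_lattice fullv [set x : X | forall f : dual X, J f -> f x \is a Num.int].
Proof.
move=> /lattice_basis[b [bb JE]].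
have [u uE] : exists u : 'I_(\dim {:dual X}) -> X,
    forall i (f : dual X), coord b i f = f (u i).
  have H k := bidual_eval (linfun (coord b k : dual X -> rat^o)).
  by have [u uE] := choice H; exists u => i f; rewrite -uE lfunE.
have expand x : x = \sum_(i < \dim {:dual X}) (b`_i : dual X) x *: u i.
  apply/eqP; rewrite -subr_eq0; apply/eqP/dual_separates => f.
  rewrite dualD dualN linear_sum /=.
  rewrite {1}[f](coord_basis bb (memvf f)) sum_lfunE -sumrB big1 // => i _.
  by rewrite scale_lfunE dualZ uE; apply/eqP; rewrite subr_eq0 mulrC.
have nthu (i : 'I_(\dim {:dual X})) : [tuple u i | i < \dim {:dual X}]`_i = u i.
  by rewrite -tnth_nth tnth_mktuple.
exists (\dim {:dual X}), [tuple u i | i < \dim {:dual X}]; split.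
  apply/vspaceP => x; rewrite memvf (expand x) rpred_sum // => i _.
  by rewrite rpredZ // -nthu memv_span // mem_nth // size_tuple.
apply/seteqP; split=> [x xJ|_ [a ->] f /JE fb].
  exists [ffun i : 'I_(\dim {:dual X}) => Num.floor ((b`_i : dual X) x)].
  rewrite {1}(expand x); apply: eq_bigr => i _; rewrite nthu ffunE -scaler_int.
  rewrite floorK // xJ //; apply/JE => j.
  by rewrite coord_free ?(basis_free bb) //; case: eqP.
rewrite linear_sum rpred_sum // => i _; rewrite /= nthu -scaler_int dualZ -uE.
by rewrite rpredM ?intr_int.
Qed.

Lemma end_det_comp (M N : 'End(X)) :
  end_det (M \o N)%VF = end_det M * end_det N.
Proof.
by rewrite /end_det (mxof_comp _ _ (vbasisP _)) det_mulmx mulrC.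
Qed.

Lemma end_det1 : end_det (\1%VF : 'End(X)) = 1.
Proof. by rewrite /end_det mxof1 ?det1 // (basis_free (vbasisP _)). Qed.

Lemma end_det_int (J : set X) (M : 'End(X)) : is_lattice fullv J ->
  (forall x, J x -> J (M x)) -> end_det M \is a Num.int.
Proof.
move=> /lattice_basis[b [bb JE]] MJ; pose e := vbasis {:X}.
have eb : basis_of {:X} e := vbasisP _.
(* The determinant is defined through [vbasis]; in a basis of [J] the matrix becomes integral. *)
have -> : end_det M = \det (mxof b b M).
  have MM : mxof e e M = mxof e b \1%VF *m mxof b b M *m mxof b e \1%VF.
    by rewrite -(mxof_comp _ _ bb) -(mxof_comp _ _ bb) comp_lfun1r comp_lfun1l.
  have I1 : mxof b e \1%VF *m mxof e b \1%VF = 1%:M.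
    by rewrite -(mxof_comp _ _ eb) comp_lfun1l mxof1 // (basis_free bb).
  have d1 : \det (mxof b e \1%VF) * \det (mxof e b \1%VF) = 1.
    by rewrite -det_mulmx I1 det1.
  by rewrite /end_det -/e MM !det_mulmx -[RHS]mulr1 -d1; ring.
rewrite /determinant rpred_sum // => s _.
rewrite rpredM ?rpredX ?rpredN // rpred_prod // => i _.
have /MJ/JE bM : J b`_i.
  by apply/JE => j; rewrite coord_free ?(basis_free bb) //; case: eqP.
by rewrite !mxE /= vecof_delta; exact: bM.
Qed.

(** The determinants of [M] and of its inverse are both integers, hence equal to 1 or -1. *)
Lemma end_det_lattice_aut (J : set X) (M : 'End(X)) : is_lattice fullv J ->
  lker M == 0%VS -> M @` J = J -> 0 < end_det M -> end_det M = 1.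
Proof.
move=> Jl kM MJ dM.
have dMi : end_det M \is a Num.int.
  by apply: (end_det_int Jl) => x Jx; rewrite -MJ; exists x.
have dVi : end_det (M^-1)%VF \is a Num.int.
  apply: (end_det_int Jl) => x; rewrite -{1}MJ => -[y Jy <-].
  by rewrite lker0_lfunK.
have d1 : end_det M * end_det (M^-1)%VF = 1.
  rewrite -end_det_comp -[RHS]end_det1; congr end_det; apply/lfunP => x.
  by rewrite comp_lfunE id_lfunE lker0_lfunVK_end.
have [[k Mk] [l Ml]] := (intrP dMi, intrP dVi).
move: d1 dM; rewrite Mk Ml -intrM ltr0z => /eqP.
rewrite -[1]/(1%:~R) eqr_int => /eqP kl k0.
have /eqP := congr1 absz kl; rewrite abszM muln_eq1 => /andP[/eqP k1 _].
by rewrite -[k]gtz0_abs // k1.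
Qed.

Variables (B : {symmetric X}) (J : set X).
Hypothesis ndB : nondegenerate B.
Hypothesis JB : forall x y, J x -> J y -> J (x - y).
Hypothesis J_dual : J `<=` dual_lattice B J.
Hypothesis J_bidual : forall x,
  (forall nu, dual_lattice B J nu -> B x nu \is a Num.int) -> J x.

Lemma isometry_lker (A : 'End(X)) : isometry B B A -> lker A == 0%VS.
Proof.
move=> iso; rewrite -subv0; apply/subvP => x; rewrite memv_ker memv0 => /eqP Ax.
have /nondegenerateP nd := ndB; apply/eqP/nd => y.
by rewrite -iso Ax symf0l.
Qed.

(** For surjectivity, the preimage of y pairs with nu as y pairs with A nu, which is nu plus an
    element of [J]; so the preimage lies in the bidual of [J]. *)
Lemma isometry_lattice (A : 'End(X)) : isometry B B A ->
  (forall nu, dual_lattice B J nu -> J (A nu - nu)) -> A @` J = J.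
Proof.
move=> iso triv; apply/seteqP; split=> [_ [x Jx <-]|y Jy].
  have J0 : J 0 by rewrite -(subrr x); exact: JB.
  rewrite -[A x](subrK x) -[X in _ + X]opprK; apply: JB.
    by apply: triv; exact: J_dual.
  by rewrite -sub0r; exact: JB.
exists ((A^-1)%VF y); last by rewrite lker0_lfunVK_end ?isometry_lker.
apply: J_bidual => nu nuJ.
rewrite -iso lker0_lfunVK_end ?isometry_lker // -[A nu](subrK nu) symfDr.
rewrite rpredD //.
  by apply: (J_dual Jy); exact: triv.
by rewrite symf_sym; exact: nuJ.
Qed.

End IntegralLattices.

Lemma even_lattice_integral (X : vectType rat) (B : {symmetric X}) (L : set X) :
  even_lattice B L -> L `<=` dual_lattice B L.
Proof.
move=> [Ll Lev] x Lx y Ly.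
have Lxy : L (x - y) by exact: is_latticeB Ll Lx Ly.
have -> : B x y = B x x / 2 + B y y / 2 - B (x - y) (x - y) / 2.
  by rewrite !symfE (symf_sym B y x); field.
by rewrite rpredB ?rpredD ?Lev.
Qed.

Lemma lattice_form_bidual (X : vectType rat) (B : {symmetric X}) (L : set X) x :
  nondegenerate B -> is_lattice fullv L ->
  (forall nu, dual_lattice B L nu -> B x nu \is a Num.int) -> L x.
Proof.
move=> nd Ll xint; apply: (lattice_bidual Ll) => phi phiL.
rewrite -(flat_bij nd phi) flatE symf_sym; apply: xint => y Ly.
by rewrite -flatE flat_bij // phiL.
Qed.

(** * Coordinates on the parabolic subgroup *)

Section Coordinates.
Variables (V : vectType rat) (B : {symmetric V}) (U Ut : {vspace V}).
Variables (W : vectType rat) (BW : {symmetric W}).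
Variable p : 'Hom(subvs_of (orthov B U), W).
Variable alpha : 'Hom(subvs_of Ut, subvs_of U).
Hypothesis ndB : nondegenerate B.
Hypothesis isoU : (U <= orthov B U)%VS.
Hypothesis subqW : is_subquotient BW p.
Hypothesis Ut_inj : forall t, t \in Ut -> pairing B U t = 0 -> t = 0.
Hypothesis Ut_onto : forall f, exists2 t, t \in Ut & pairing B U t = f.
Hypothesis alphaP : is_alpha B alpha.

Local Notation Wt := (Wt B U Ut).

Lemma pairingE v (u : subvs_of U) : pairing B U v u = B v (vsval u).
Proof. by rewrite linfunE // => a x y; rewrite !vsvalE symfDr symfZr. Qed.

Lemma pairing_linear : linear (pairing B U).
Proof.
move=> a x y; apply: dualP => u.
by rewrite add_lfunE scale_lfunE !pairingE symfDl symfZl.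
Qed.

Lemma pairingZ a v : pairing B U (a *: v) = a *: pairing B U v.
Proof.
by apply: dualP => u; rewrite scale_lfunE !pairingE symfZl.
Qed.

Lemma Ut_dualE t : Ut_dual B U Ut t = pairing B U (vsval t).
Proof. by rewrite linfunE // => a x y; rewrite !vsvalE pairing_linear. Qed.

Lemma Ut_dualK : cancel (Ut_dual B U Ut) ((Ut_dual B U Ut)^-1)%VF.
Proof.
apply: lker0_lfunK; rewrite -subv0; apply/subvP => t.
rewrite memv_ker memv0 Ut_dualE => /eqP t0; apply/eqP/val_inj => /=.
by apply: Ut_inj => //; exact: subvsP.
Qed.

Lemma Ut_dualVK : cancel ((Ut_dual B U Ut)^-1)%VF (Ut_dual B U Ut).
Proof.
move=> f; apply: limg_lfunVK; have [t tU <-] := Ut_onto f.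
apply/memv_imgP; exists (vsproj Ut t); rewrite ?memvf // Ut_dualE.
by rewrite vsprojK.
Qed.

(* tlift and wlift undo the identifications of Ut with U^* and of Wt with W, so
   that all maps live on U, W and U^* and no tilde is needed. *)
Definition tlift : 'Hom(dual (subvs_of U), V) :=
  linfun (fun f => vsval (((Ut_dual B U Ut)^-1)%VF f)).

Definition wlift : 'Hom(W, V) :=
  linfun (fun w => vsval (((Wt_W Ut p)^-1)%VF w)).

Definition alpha_dual : 'Hom(dual (subvs_of U), subvs_of U) :=
  (alpha \o (Ut_dual B U Ut)^-1)%VF.

Lemma tliftE f : tlift f = vsval (((Ut_dual B U Ut)^-1)%VF f).
Proof. by rewrite linfunE // => a x y; rewrite !linearP. Qed.

Lemma wliftE w : wlift w = vsval (((Wt_W Ut p)^-1)%VF w).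
Proof. by rewrite linfunE // => a x y; rewrite !linearP. Qed.

Lemma tlift_Ut f : tlift f \in Ut.
Proof. by rewrite tliftE subvsP. Qed.

Lemma form_tU f (u : subvs_of U) : B (tlift f) (vsval u) = f u.
Proof. by rewrite -pairingE tliftE -Ut_dualE Ut_dualVK. Qed.

Lemma form_UU (u u' : subvs_of U) : B (vsval u) (vsval u') = 0.
Proof.
have /mem_orthovP := subvP isoU _ (subvsP u).
by apply; exact: subvsP.
Qed.

Lemma tlift_pairing t : t \in Ut -> tlift (pairing B U t) = t.
Proof.
move=> tU; rewrite -{1}(vsprojK tU) -Ut_dualE tliftE Ut_dualK.
by rewrite vsprojK.
Qed.

Lemma mem_WtP v : (v \in Wt) <->
  (forall u : subvs_of U, B v (vsval u) = 0) /\ (forall f, B v (tlift f) = 0).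
Proof.
split=> [/mem_orthovP vW|[vU vT]].
  split=> [u|f]; apply: vW.
    by apply: (subvP (addvSl _ _)); exact: subvsP.
  by apply: (subvP (addvSr _ _)); exact: tlift_Ut.
apply/mem_orthovP => _ /memv_addP[u uU [t tU ->]].
by rewrite symfDr -(vsprojK uU) vU add0r -(tlift_pairing tU) vT.
Qed.

(** Orthogonalisation in two stages: [tlift f] absorbs the pairing of v with U, then a vector of U,
    found by biduality, absorbs the remaining pairing with [Ut]. Isotropy of U keeps the first stage
    intact. *)
Lemma decomp_exists v : exists u : subvs_of U, exists2 y, y \in Wt &
  exists f, v = vsval u + y + tlift f.
Proof.
pose f := pairing B U v; pose x := v - tlift f.
have xU (u : subvs_of U) : B x (vsval u) = 0.
  by rewrite /x symfDl symfNl form_tU pairingE subrr.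
have lin : linear (fun g : dual (subvs_of U) => B x (tlift g) : rat^o).
  by move=> a g1 g2; rewrite (linearP tlift) symfDr symfZr.
have [u uE] := bidual_eval (linfun (fun g => B x (tlift g) : rat^o)).
have {}uE f' := etrans (esym (linfunE lin f')) (uE f').
exists u, (x - vsval u); last first.
  by exists f; rewrite [vsval u + _]addrC subrK /x subrK.
apply/mem_WtP; split=> [u'|g]; rewrite symfDl symfNl.
  by rewrite xU form_UU subrr.
by rewrite (symf_sym B (vsval u)) form_tU -uE subrr.
Qed.

Lemma orthU_mem v : (forall u : subvs_of U, B v (vsval u) = 0) ->
  v \in orthov B U.
Proof. by move=> vU; apply/mem_orthovP => u uU; rewrite -(vsprojK uU) vU. Qed.

Lemma Wt_orthU v : v \in Wt -> v \in orthov B U.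
Proof. by move=> /mem_WtP[vU _]; exact: orthU_mem. Qed.

Lemma Wt_WE y : Wt_W Ut p y = p (vsproj (orthov B U) (vsval y)).
Proof. by rewrite linfunE // => a x z; rewrite !linearP. Qed.

Lemma U_separated (u : subvs_of U) : (forall f, B (vsval u) (tlift f) = 0) ->
  u = 0.
Proof.
by move=> u0; apply: dual_separates => f; rewrite -form_tU symf_sym.
Qed.

Lemma Wt_WK : cancel (Wt_W Ut p) ((Wt_W Ut p)^-1)%VF.
Proof.
have [_ pker _] := subqW.
apply: lker0_lfunK; rewrite -subv0; apply/subvP => y.
rewrite memv_ker memv0 Wt_WE pker vsprojK ?Wt_orthU ?subvsP // => yU.
have /mem_WtP[_ yT] := subvsP y.
apply/eqP/val_inj; rewrite /= -(vsprojK yU).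
by rewrite (U_separated (u := vsproj U (vsval y))) // => f; rewrite vsprojK.
Qed.

Lemma Wt_WVK : cancel ((Wt_W Ut p)^-1)%VF (Wt_W Ut p).
Proof.
have [pim pker _] := subqW.
move=> w; apply: limg_lfunVK.
have : w \in limg p by rewrite pim memvf.
move=> /memv_imgP[x _ ->]; apply/memv_imgP.
have [u [y yW [f xE]]] := decomp_exists (vsval x).
have f0 : f = 0.
  apply: dualP => u'; rewrite zero_lfunE -form_tU.
  have /mem_orthovP/(_ _ (subvsP u')) := subvsP x.
  have /mem_WtP[yU _] := yW.
  by rewrite xE !symfDl form_UU yU !add0r.
exists (vsproj Wt y); rewrite ?memvf // Wt_WE vsprojK //.
apply/eqP; rewrite -subr_eq0 -linearB /= pker linearB /=.
by rewrite vsprojK ?Wt_orthU // xE f0 linear0 addr0 addrK subvsP.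
Qed.

Lemma wlift_Wt w : wlift w \in Wt. Proof. by rewrite wliftE subvsP. Qed.

Lemma wlift_orthU w : wlift w \in orthov B U.
Proof. exact/Wt_orthU/wlift_Wt. Qed.

Lemma p_wlift w : p (vsproj (orthov B U) (wlift w)) = w.
Proof. by rewrite wliftE -Wt_WE Wt_WVK. Qed.

Lemma form_WU w (u : subvs_of U) : B (wlift w) (vsval u) = 0.
Proof. by have /mem_WtP[] := wlift_Wt w. Qed.

Lemma form_WT w f : B (wlift w) (tlift f) = 0.
Proof. by have /mem_WtP[] := wlift_Wt w. Qed.

Lemma form_WW w w' : B (wlift w) (wlift w') = BW w w'.
Proof.
have [_ _ pB] := subqW.
by rewrite -{2}(p_wlift w) -{2}(p_wlift w') pB !vsprojK ?wlift_orthU.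
Qed.

Lemma alpha_dual_sym (f g : dual (subvs_of U)) :
  f (alpha_dual g) = g (alpha_dual f).
Proof.
have [asym _] := alphaP.
rewrite -!form_tU !tliftE !comp_lfunE; exact: asym.
Qed.

(** Expanding the isotropy of the vectors t - alpha t shows that alpha is half the Gram form of
    [Ut]. *)
Lemma form_TT (f g : dual (subvs_of U)) :
  B (tlift f) (tlift g) = 2 * f (alpha_dual g).
Proof.
have [asym aiso] := alphaP.
have := aiso (((Ut_dual B U Ut)^-1)%VF f) (((Ut_dual B U Ut)^-1)%VF g).
have <- := tliftE f; have <- := tliftE g.
have aE h : alpha (((Ut_dual B U Ut)^-1)%VF h) = alpha_dual h.
  by rewrite comp_lfunE.
rewrite !aE !symfE form_UU form_tU (symf_sym B (vsval _)) form_tU.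
rewrite (alpha_dual_sym g) => H; lra.
Qed.

Definition coords_inv : 'Hom((subvs_of U * W * dual (subvs_of U))%type, V) :=
  linfun (fun x => vsval x.1.1 + wlift x.1.2 + tlift x.2).

Lemma coords_invE u w f :
  coords_inv (u, w, f) = vsval u + wlift w + tlift f.
Proof.
rewrite linfunE // => a [[u1 w1] f1] [[u2 w2] f2].
change (vsval (a *: u1 + u2) + wlift (a *: w1 + w2) + tlift (a *: f1 + f2) =
  a *: (vsval u1 + wlift w1 + tlift f1) + (vsval u2 + wlift w2 + tlift f2)).
rewrite !vsvalE (linearP wlift) (linearP tlift) !scalerDr.
by rewrite [RHS]addrACA; congr (_ + _); rewrite [RHS]addrACA.
Qed.

Lemma coords_inv_ker : lker coords_inv == 0%VS.
Proof.
rewrite -subv0; apply/subvP => -[[u w] f].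
rewrite memv_ker memv0 coords_invE => /eqP e0.
have f0 : f = 0.
  apply: dualP => u'; rewrite zero_lfunE -form_tU.
  have := symf0l B (vsval u').
  by rewrite -e0 !symfE form_UU form_WU !add0r.
rewrite f0 linear0 addr0 in e0 *.
have u0 : u = 0.
  apply: U_separated => g; have := symf0l B (tlift g).
  by rewrite -e0 !symfE form_WT addr0.
rewrite u0 vsval0 add0r in e0 *.
by rewrite -(p_wlift w) e0 !linear0.
Qed.

Lemma coords_inv_im : limg coords_inv = fullv.
Proof.
apply/vspaceP => v; rewrite memvf; apply/memv_imgP.
have [u [y yW [f ->]]] := decomp_exists v.
exists (u, Wt_W Ut p (vsproj Wt y), f); rewrite ?memvf // coords_invE.
by rewrite wliftE Wt_WK vsprojK.
Qed.

Let coords v := (coords_inv^-1)%VF v.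

Definition cU : 'Hom(V, subvs_of U) := linfun (fun v => (coords v).1.1).
Definition cW : 'Hom(V, W) := linfun (fun v => (coords v).1.2).
Definition cF : 'Hom(V, dual (subvs_of U)) := linfun (fun v => (coords v).2).

Let cUE v : cU v = (coords v).1.1.
Proof. by rewrite linfunE // => a x y; rewrite /coords linearP. Qed.
Let cWE v : cW v = (coords v).1.2.
Proof. by rewrite linfunE // => a x y; rewrite /coords linearP. Qed.
Let cFE v : cF v = (coords v).2.
Proof. by rewrite linfunE // => a x y; rewrite /coords linearP. Qed.

Definition emb (u : subvs_of U) (w : W) (f : dual (subvs_of U)) : V :=
  vsval u + wlift w + tlift f.

Lemma embK v : emb (cU v) (cW v) (cF v) = v.
Proof.
rewrite /emb -coords_invE cUE cWE cFE -!surjective_pairing.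
by apply: limg_lfunVK; rewrite coords_inv_im memvf.
Qed.

Lemma embP v : exists u w f, v = emb u w f.
Proof. by exists (cU v), (cW v), (cF v); rewrite embK. Qed.

Lemma cU_emb u w f : cU (emb u w f) = u.
Proof.
by rewrite cUE /coords /emb -coords_invE lker0_lfunK ?coords_inv_ker.
Qed.

Lemma cW_emb u w f : cW (emb u w f) = w.
Proof.
by rewrite cWE /coords /emb -coords_invE lker0_lfunK ?coords_inv_ker.
Qed.

Lemma cF_emb u w f : cF (emb u w f) = f.
Proof.
by rewrite cFE /coords /emb -coords_invE lker0_lfunK ?coords_inv_ker.
Qed.

Lemma embD u w f u' w' f' :
  emb u w f + emb u' w' f' = emb (u + u') (w + w') (f + f').
Proof.
rewrite /emb vsvalD !linearD /=.
by rewrite addrACA; congr (_ + _); rewrite addrACA.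
Qed.

Lemma embN u w f : - emb u w f = emb (- u) (- w) (- f).
Proof. by rewrite /emb vsvalN !linearN /= !opprD. Qed.

Lemma embU u : emb u 0 0 = vsval u.
Proof. by rewrite /emb !linear0 !addr0. Qed.
Lemma embW w : emb 0 w 0 = wlift w.
Proof. by rewrite /emb vsval0 linear0 addr0 add0r. Qed.
Lemma embT f : emb 0 0 f = tlift f.
Proof. by rewrite /emb vsval0 linear0 !add0r. Qed.

Lemma form_emb u w f u' w' f' : B (emb u w f) (emb u' w' f') =
  f u' + f' u + BW w w' + 2 * f (alpha_dual f').
Proof.
rewrite /emb !symfE form_UU form_WW form_TT form_WU form_WT !form_tU.
rewrite (symf_sym B (vsval u) (wlift w')) form_WU.
rewrite (symf_sym B (vsval u)) form_tU (symf_sym B (tlift f) (wlift w')).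
by rewrite form_WT; ring.
Qed.

(** The coordinate in U^* is independent of the complement, and on L^* it takes values in I^*. *)
Lemma cFE_pairing v : cF v = pairing B U v.
Proof.
apply: dualP => u; rewrite pairingE -{2}(embK v) -embU form_emb.
by rewrite symf0r !linear0 zero_lfunE mulr0 !addr0.
Qed.

Lemma orthU_cF v : v \in orthov B U -> cF v = 0.
Proof.
move=> /mem_orthovP vU; apply: dualP => u.
by rewrite cFE_pairing pairingE zero_lfunE vU ?subvsP.
Qed.

Lemma mem_U_emb v : v \in U -> v = emb (vsproj U v) 0 0.
Proof. by move=> vU; rewrite embU vsprojK. Qed.

Lemma p_emb u w : p (vsproj (orthov B U) (emb u w 0)) = w.
Proof.
have [_ pker _] := subqW.
rewrite /emb linear0 addr0 !linearD /= p_wlift -[RHS]add0r; congr (_ + _).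
by apply/eqP; rewrite pker vsprojK ?subvsP // (subvP isoU) ?subvsP.
Qed.

Lemma ndBW : nondegenerate BW.
Proof.
apply/nondegenerateP => w w0.
have : wlift w = 0.
  have /nondegenerateP := ndB; apply => v; rewrite -(embK v) -embW form_emb.
  by rewrite !(w0, zero_lfunE, linear0, mulr0, addr0).
by move=> e; rewrite -(p_wlift w) e !linear0.
Qed.

Lemma directv_sum : directv (U + Wt + Ut).
Proof.
have cap0 (X Y : {vspace V}) :
    (X :&: Y = 0)%VS -> \dim (X + Y) = (\dim X + \dim Y)%N.
  by move=> XY; rewrite -dimv_sum_cap XY dimv0 addn0.
have memW y : y \in Wt -> y = emb 0 (Wt_W Ut p (vsproj Wt y)) 0.
  by move=> yW; rewrite embW wliftE Wt_WK vsprojK.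
have memT t : t \in Ut -> t = emb 0 0 (pairing B U t).
  by move=> tU; rewrite embT tlift_pairing.
apply/directvP => /=; rewrite !cap0 //.
  apply/eqP; rewrite -subv0; apply/subvP => v; rewrite memv_cap memv0.
  move=> /andP[/mem_U_emb -> /memW/(congr1 cU)].
  by rewrite !cU_emb => ->; rewrite embU.
apply/eqP; rewrite -subv0; apply/subvP => v; rewrite memv_cap memv0.
move=> /andP[/memv_addP[u /mem_U_emb -> [w /memW -> ->]]].
rewrite embD !addr0 => /memT e; move: (congr1 cU e) (congr1 cW e).
by rewrite !(cU_emb, cW_emb) !add0r => -> ->; rewrite embU.
Qed.

(** * Block formula, isometry and Levi factors *)

Section Element.
Variables (M : 'End(subvs_of U)) (gamma : 'End(W)).
Variables (psi : 'Hom(W, subvs_of U)).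
Variable eta : 'Hom(dual (subvs_of U), subvs_of U).

Local Notation A := (parabolic_elt BW p alpha M gamma psi eta).
Let M' := ((dual_map M)^-1)%VF.

Lemma parabolic_emb u w f : A (emb u w f) =
  emb (M u - psi (gamma w) + (M (alpha_dual f) - alpha_dual (M' f)
         - 2^-1 *: psi (adjoint BW psi (M' f)) - eta (M' f)))
      (gamma w + adjoint BW psi (M' f)) (M' f).
Proof.
rewrite [in LHS]/emb wliftE tliftE parabolic_eltE ?directv_sum //.
rewrite /elt_U /elt_Wt /elt_Ut !comp_lfunE !Wt_WVK !Ut_dualVK.
rewrite -!wliftE -!tliftE -!embU -!embW -!embT !(embN, embD).
by rewrite !(addr0, add0r, oppr0, sub0r).
Qed.

Lemma parabolic_U u : A (vsval u) = vsval (M u).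
Proof.
by rewrite -embU parabolic_emb !(linear0, addr0) embU.
Qed.

(** On [Ut] the isometry condition prescribes only a symmetric part of the U-component: the alpha
    terms and -psi psi^*/2 provide it, and eta drops out by antisymmetry. *)
Lemma parabolic_isometry : lker M == 0%VS -> isometry BW BW gamma ->
  antisymmetric_map eta -> isometry B B A.
Proof.
move=> kM iso anti x y.
have [u [w [f ->]]] := embP x; have [u' [w' [f' ->]]] := embP y.
rewrite !parabolic_emb !form_emb !symfE iso !adjointE ?ndBW //.
have M'M g v : M' g (M v) = g v by exact: dual_map_inv.
rewrite (symf_sym BW (gamma w)) adjointE ?ndBW //.
rewrite !dualE !M'M.
have := symf_sym BW (adjoint BW psi (M' f)) (adjoint BW psi (M' f')).
rewrite !adjointE ?ndBW // => hf.
have ha := alpha_dual_sym (M' f) (M' f').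
have hae := anti (M' f) (M' f').
have hal := alpha_dual_sym f f'.
by rewrite hf ha hae hal; field.
Qed.
End Element.

Lemma adjoint0 f : adjoint BW (0 : 'Hom(W, subvs_of U)) f = 0.
Proof.
have /nondegenerateP := ndBW; apply => x.
by rewrite adjointE ?ndBW // zero_lfunE linear0.
Qed.

Lemma levi_emb M gamma u w f :
  parabolic_elt BW p alpha M gamma 0 0 (emb u w f) =
  emb (M u + (M (alpha_dual f) - alpha_dual (((dual_map M)^-1)%VF f)))
      (gamma w) (((dual_map M)^-1)%VF f).
Proof.
rewrite parabolic_emb adjoint0 !zero_lfunE addr0.
by rewrite !(scaler0, oppr0, addr0).
Qed.

Lemma levi1_emb gamma u w f :
  parabolic_elt BW p alpha \1%VF gamma 0 0 (emb u w f) = emb u (gamma w) f.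
Proof. by rewrite levi_emb dual_map_inv1 !id_lfunE subrr addr0. Qed.

Lemma unipotent_emb psi eta u w f :
  unipotent_elt BW p alpha (psi, eta) (emb u w f) =
  emb (u - psi w - 2^-1 *: psi (adjoint BW psi f) - eta f)
      (w + adjoint BW psi f) f.
Proof.
rewrite /unipotent_elt parabolic_emb dual_map_inv1 !id_lfunE subrr add0r.
by rewrite !addrA.
Qed.

(** The alpha corrections telescope, so the Levi elements multiply even when [Ut] is not
    isotropic. *)
Lemma levi_comp M N : lker M == 0%VS -> lker N == 0%VS ->
  parabolic_elt BW p alpha (M \o N)%VF \1%VF 0 0 =
  (parabolic_elt BW p alpha M \1%VF 0 0 \o
   parabolic_elt BW p alpha N \1%VF 0 0)%VF.
Proof.
move=> kM kN; apply/lfunP => v; have [u [w [f ->]]] := embP v.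
rewrite comp_lfunE !levi_emb !id_lfunE.
have -> : ((dual_map (M \o N))^-1)%VF f =
    ((dual_map M)^-1)%VF (((dual_map N)^-1)%VF f).
  apply/esym/dual_map_inv_unique => [|x].
    by rewrite lker0_comp.
  by rewrite comp_lfunE !dual_map_inv.
rewrite !comp_lfunE; congr emb.
by rewrite !(linearD, linearN) /= -!addrA; congr (_ + (_ + _)); rewrite addKr.
Qed.

(** Each of the three factors is joined to 1 by its own argument. *)
Lemma parabolic_factor M gamma psi eta :
  parabolic_elt BW p alpha M gamma psi eta =
  (unipotent_elt BW p alpha (psi, eta) \o
    (parabolic_elt BW p alpha \1%VF gamma 0 0 \o
     parabolic_elt BW p alpha M \1%VF 0 0))%VF.
Proof.
apply/lfunP => v; have [u [w [f ->]]] := embP v.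
rewrite !comp_lfunE levi_emb levi1_emb unipotent_emb id_lfunE parabolic_emb.
congr emb; rewrite !addrA; congr (_ - _ - _).
by rewrite [RHS]addrAC; congr (_ - _); exact: addrAC.
Qed.

Lemma parabolic_mem_U M gamma psi eta u : u \in U ->
  parabolic_elt BW p alpha M gamma psi eta u \in U.
Proof. by move=> uU; rewrite -(vsprojK uU) parabolic_U subvsP. Qed.

Lemma unipotent_isometry psi eta : antisymmetric_map eta ->
  isometry B B (unipotent_elt BW p alpha (psi, eta)).
Proof.
move=> anti; apply: parabolic_isometry => //; last exact: id_isometry.
by rewrite lker_id.
Qed.

(** * Identity components in coordinates *)

Section RealComponents.
Variable R : realType.

Lemma unipotent_component0 psi eta : antisymmetric_map eta ->
  real_parabolic0 B U (real_mx R (unipotent_elt BW p alpha (psi, eta))).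
Proof.
move=> anti; apply: real_parabolic0_unipotent => //.
- exact: unipotent_isometry.
- by move=> u; exact: parabolic_mem_U.
apply/lfunP => v; have [u [w [f ->]]] := embP v.
(* A - 1 sends V into U^perp, U^perp into U, and U to 0; hence its cube vanishes. *)
have NE u' w' f' :
    (unipotent_elt BW p alpha (psi, eta) - \1)%VF (emb u' w' f') =
    emb (- psi w' - 2^-1 *: psi (adjoint BW psi f') - eta f')
      (adjoint BW psi f') 0.
  rewrite add_lfunE opp_lfunE id_lfunE unipotent_emb embN embD subrr.
  congr emb; last by rewrite addrC addKr.
  by rewrite -!addrA addrC !addrA subrK.
rewrite zero_lfunE !comp_lfunE !NE !(linear0, oppr0, scaler0, addr0).
by rewrite embU.
Qed.

(** Already the square of A - 1 vanishes: it acts by D on U and by minus the transpose of D on U^*,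
    and the two mixed terms D alpha D' cancel. *)
Lemma levi_square_zero (D : 'End(subvs_of U)) : (D \o D)%VF = 0 ->
  real_parabolic0 B U
    (real_mx R (parabolic_elt BW p alpha (\1 + D)%VF \1%VF 0 0)).
Proof.
move=> D0; have DD x : D (D x) = 0 by rewrite -comp_lfunE D0 zero_lfunE.
have kD : lker (\1 + D)%VF == 0%VS.
  rewrite -subv0; apply/subvP => x; rewrite memv_ker memv0.
  rewrite add_lfunE id_lfunE => /eqP xD.
  have := congr1 D xD; rewrite linearD /= DD addr0 linear0 => Dx.
  by move: xD; rewrite Dx addr0 => ->.
apply: real_parabolic0_unipotent => //.
- apply: parabolic_isometry => //; [exact: id_isometry|exact: antisymmetric0].
- by move=> u; exact: parabolic_mem_U.
pose D' (f : dual (subvs_of U)) : dual (subvs_of U) := - (f \o D)%VF.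
have D'E f : ((dual_map (\1 + D))^-1)%VF f = f + D' f.
  apply/esym/dual_map_inv_unique => // x.
  rewrite !(add_lfunE, opp_lfunE, comp_lfunE, id_lfunE) !linearD /= DD.
  by rewrite linear0 addr0 addrK.
have D'D f : D' (D' f) = 0.
  apply: dualP => x; rewrite /D' !(opp_lfunE, comp_lfunE) DD.
  by rewrite linear0 !oppr0 zero_lfunE.
have NE u w f :
    (parabolic_elt BW p alpha (\1 + D)%VF \1%VF 0 0 - \1)%VF (emb u w f) =
    emb (D u + D (alpha_dual f) - alpha_dual (D' f)) 0 (D' f).
  rewrite add_lfunE opp_lfunE id_lfunE levi_emb embN embD id_lfunE subrr D'E.
  congr emb; last by rewrite addrC addKr.
  rewrite !add_lfunE !id_lfunE (linearD alpha_dual) /= opprD.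
  rewrite [_ + D (alpha_dual f)]addrC !addrA addrK.
  by apply: (canLR (addrK u)); rewrite [RHS]addrC !addrA.
apply/lfunP => v; have [u [w [f ->]]] := embP v.
rewrite zero_lfunE !comp_lfunE NE.
suff N2 u' f' : (parabolic_elt BW p alpha (\1 + D)%VF \1%VF 0 0 - \1)%VF
    (emb (D u' + D (alpha_dual f') - alpha_dual (D' f')) 0 (D' f')) = 0.
  by rewrite N2 linear0.
rewrite NE D'D !(linearD, linearN) /= !DD linear0 oppr0 !add0r addr0.
by rewrite addNr embU.
Qed.

Lemma levi_component0 M : end_det M = 1 ->
  real_parabolic0 B U (real_mx R (parabolic_elt BW p alpha M \1%VF 0 0)).
Proof.
pose e := vbasis {:subvs_of U}.
have eb : basis_of {:subvs_of U} e := vbasisP _.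
(* Nonvanishing of the determinant is carried along because [levi_comp] asks for injective maps. *)
pose P m := end_det (hommx e e m) != 0 /\ real_parabolic0 B U
  (real_mx R (parabolic_elt BW p alpha (hommx e e m) \1%VF 0 0)).
move=> dM; suff [] : P (mxof e e M) by rewrite mxofK.
move: dM; rewrite /end_det -/e; move: (mxof e e M).
have PE m : P m -> lker (hommx e e m) == 0%VS by move=> [/end_det_lker].
apply: sl_square_zero_ind => [N N0|C D PC PD].
  split.
    rewrite /end_det -/e hommxK //.
    have : (1%:M + N) *m (1%:M - N) = 1%:M.
      by rewrite mulmxBr mulmx1 mulmxDl mul1mx N0 addr0 addrK.
    by move=> /mulmx1_unit[]; rewrite unitmxE unitfE.
  rewrite linearD /= hommx1 //; apply: levi_square_zero.
  by rewrite -hommx_mul // N0 linear0.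
split.
  rewrite /end_det -/e hommxK // det_mulmx mulf_neq0 //.
    by have [+ _] := PC; rewrite /end_det hommxK.
  by have [+ _] := PD; rewrite /end_det hommxK.
rewrite (hommx_mul eb eb eb) levi_comp ?PE //.
rewrite -[real_mx _ _]/(realmx _ _) realmx_comp.
by apply: real_parabolic0M; [case: PC|case: PD].
Qed.

Lemma gamma_component0 gamma : real_SOplus BW (real_mx R gamma) ->
  real_parabolic0 B U (real_mx R (parabolic_elt BW p alpha \1%VF gamma 0 0)).
Proof.
pose J := realmx R cW; pose K := realmx R wlift.
(* Affine in g: it extends g by the identity on U and [Ut]. *)
pose f (g : 'M[R]_(\dim {:W})) := 1%:M + J *m (g - 1%:M) *m K.
have -> : real_mx R (parabolic_elt BW p alpha \1%VF gamma 0 0) =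
    f (real_mx R gamma).
  have e : real_mx R gamma - 1%:M = realmx R (gamma - \1)%VF.
    by rewrite realmxD realmxN realmx1.
  rewrite /f e -!realmx_comp -(realmx1 R V) -realmxD -[LHS]/(realmx R _).
  congr realmx; apply/lfunP => v.
  have [u [w [h ->]]] := embP v.
  rewrite levi1_emb !(add_lfunE, comp_lfunE, opp_lfunE, id_lfunE) cW_emb -embW.
  by rewrite embD !addr0 addrC subrK.
have f1 : 1%:M = f 1%:M by rewrite /f subrr mulmx0 mul0mx addr0.
have fc : continuous f.
  apply: continuous_addmx; first exact: cst_continuous.
  apply: continuous_mulmx; last exact: cst_continuous.
  apply: continuous_mulmx; first exact: cst_continuous.
  apply: continuous_addmx; last exact: cst_continuous.
  by move=> x; exact: cvg_id.
rewrite /real_parabolic0 f1; apply: connected_component_image => //.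
move=> _ [g gO <-]; apply: real_parabolic_stable => //.
  have KG : K *m real_gram R B = real_gram R BW *m J^T.
    have := @realmx_form R W V V W B BW wlift \1%VF \1%VF cW.
    rewrite !realmx1 trmx1 mulmx1 mul1mx; apply => x y.
    rewrite !id_lfunE -{1}(embK y) -embW form_emb.
    by rewrite !(zero_lfunE, linear0, add0r, mulr0, addr0).
  have KJ : K *m J = 1%:M.
    rewrite -realmx_comp -realmx1; congr realmx; apply/lfunP => w.
    by rewrite comp_lfunE id_lfunE -embW cW_emb.
  have GK : real_gram R B *m K^T = J *m real_gram R BW.
    by have := congr1 trmx KG; rewrite !trmx_mul trmxK !real_gram_tr.
  rewrite /real_O /= /f; exact: (extend_isometry_mx KG GK KJ gO).
rewrite /f mulmxDr mulmx1 !mulmxA -realmx_comp.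
have -> : (cW \o subvs_incl U)%VF = 0.
  apply/lfunP => u.
  by rewrite comp_lfunE subvs_inclE -embU cW_emb zero_lfunE.
by rewrite realmx0 !mul0mx addr0.
Qed.

Lemma parabolic_component0 M gamma psi eta : end_det M = 1 ->
  real_SOplus BW (real_mx R gamma) -> antisymmetric_map eta ->
  real_parabolic0 B U (real_mx R (parabolic_elt BW p alpha M gamma psi eta)).
Proof.
move=> dM gO anti; rewrite parabolic_factor.
rewrite -[real_mx _ _]/(realmx _ _) !realmx_comp.
apply: real_parabolic0M; last exact: unipotent_component0.
by apply: real_parabolic0M; [exact: levi_component0|exact: gamma_component0].
Qed.

(** Compression to W is continuous, but is not visibly orthogonal at real points. It is so because
    the image of W stays orthogonal to U, and the form pulled back from W differs from [B] only by
    terms pairing with U. *)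
Lemma parabolic0_gamma (A : 'End(V)) (gamma : 'End(W)) :
  real_parabolic0 B U (real_mx R A) -> (forall w, cW (A (wlift w)) = gamma w) ->
  real_SOplus BW (real_mx R gamma).
Proof.
pose J := realmx R cW; pose K := realmx R wlift.
pose I := realmx R (subvs_incl U).
move=> PA gA; pose f (C : 'M[R]_(\dim {:V})) := K *m C *m J.
have -> : real_mx R gamma = f (real_mx R A).
  rewrite /f -[real_mx R A]/(realmx R A) -!realmx_comp -[LHS]/(realmx R _).
  by congr realmx; apply/lfunP => w; rewrite !comp_lfunE gA.
have f1 : 1%:M = f 1%:M.
  rewrite /f mulmx1 -realmx_comp -realmx1; congr realmx; apply/lfunP => w.
  by rewrite comp_lfunE id_lfunE -embW cW_emb.
rewrite /real_SOplus f1; apply: connected_component_image PA.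
  apply: continuous_mulmx; last exact: cst_continuous.
  apply: continuous_mulmx; first exact: cst_continuous.
  by move=> x; exact: cvg_id.
move=> _ [C /real_parabolicE[CO /andP[_ /submxP[Y IY]]] <-].
pose G := real_gram R B.
have CG : C *m G *m C^T = G by [].
have KGI : K *m G *m I^T = 0.
  apply: realmx_form0 => w u; rewrite subvs_inclE; exact: form_WU.
(* U is contained in its image under [C], so the isometry [C] keeps the image of W orthogonal to
   U. *)
have KCGI : K *m C *m G *m I^T = 0.
  have IYt : I^T = C^T *m I^T *m Y^T by rewrite -!trmx_mul -IY.
  rewrite IYt !mulmxA -(mulmxA K C G) -(mulmxA K (C *m G)) CG KGI.
  by rewrite mul0mx.
(* Chosen so that BW (cW x) (cW y) = B x y - B x (cU y) - B (theta x) y; the summand with alpha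
   cancels the Gram form of [Ut]. *)
pose theta : 'Hom(V, subvs_of U) := (cU + 2 *: (alpha_dual \o cF))%VF.
have JGJ : J *m real_gram R BW *m J^T =
    G - G *m I^T *m (realmx R cU)^T - realmx R theta *m I *m G.
  have e1 : G *m I^T *m (realmx R cU)^T =
      realmx R \1%VF *m G *m (realmx R (subvs_incl U \o cU))^T.
    by rewrite realmx_comp trmx_mul realmx1 mul1mx !mulmxA.
  have e2 : realmx R theta *m I *m G =
      realmx R (subvs_incl U \o theta)%VF *m G *m (realmx R \1%VF)^T.
    by rewrite realmx_comp realmx1 trmx1 mulmx1.
  have e3 : G = realmx R \1%VF *m G *m (realmx R \1%VF)^T.
    by rewrite realmx1 trmx1 mulmx1 mul1mx.
  rewrite e1 e2 {1}e3 !realmx_gram; apply/matrixP => i j.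
  rewrite !mxE -!rmorphB.
  congr ratr; rewrite !id_lfunE !comp_lfunE !subvs_inclE.
  move: (_`_i) (_`_j) => x y.
  have [u [w [f' ->]]] := embP x; have [u' [w' [g' ->]]] := embP y.
  rewrite /theta add_lfunE scale_lfunE comp_lfunE.
  rewrite !(cU_emb, cW_emb, cF_emb) -!embU !form_emb !dualE.
  rewrite !(zero_lfunE, linear0, symf0l, symf0r) (alpha_dual_sym g' f').
  by ring.
have KGK : K *m G *m K^T = real_gram R BW.
  have := @realmx_form R W W V W B BW wlift wlift \1%VF \1%VF.
  rewrite !realmx1 trmx1 mulmx1 mul1mx; apply => x y.
  by rewrite !id_lfunE form_WW.
have IGC : I *m G *m C^T *m K^T = 0.
  have := congr1 trmx KCGI.
  by rewrite !trmx_mul trmxK real_gram_tr trmx0 !mulmxA.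
rewrite /f /real_O /= !trmx_mul -!(mulmxA (K *m C)) !mulmxA.
rewrite -(mulmxA (K *m C) J) -(mulmxA (K *m C) (J *m _)) JGJ.
have t1 : K *m C *m (G *m I^T *m (realmx R cU)^T) = 0.
  by rewrite !mulmxA KCGI mul0mx.
have t2 : K *m C *m (realmx R theta *m I *m G) *m C^T *m K^T = 0.
  by rewrite -[RHS](mulmx0 _ (K *m C *m realmx R theta)) -IGC !mulmxA.
rewrite 2!(mulmxBr (K *m C)) t1 subr0 2!mulmxBl t2 subr0.
by rewrite -(mulmxA K C) -(mulmxA K) CG KGK.
Qed.

End RealComponents.

(** * Arithmetic of the parabolic subgroup *)

Section Arithmetic.
Variables (L It : set V).
Hypothesis evenL : even_lattice B L.
Hypothesis unimIt : unimodular_complement B L U Ut It.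

Local Notation Ld := (dual_lattice B L).
Local Notation I := (lattice_in U L).
Local Notation Id := (lattice_in U Ld).
Local Notation Ist := (Zdual I).
Local Notation Lam := (Lambda p L).
Local Notation Lamd := (dual_lattice BW Lam).

Let latL : is_lattice fullv L. Proof. by case: evenL. Qed.
Let LB x y : L x -> L y -> L (x - y). Proof. exact: is_latticeB latL. Qed.
Let L0 : L 0. Proof. exact: is_lattice0 latL. Qed.
Let LN x : L x -> L (- x). Proof. by move=> Lx; rewrite -sub0r; exact: LB. Qed.
Let LD x y : L x -> L y -> L (x + y).
Proof. by move=> Lx Ly; rewrite -[y]opprK; apply: LB => //; exact: LN. Qed.
Let LdL x : L x -> Ld x. Proof. exact: even_lattice_integral. Qed.
Let L_bidual x : (forall nu, Ld nu -> B x nu \is a Num.int) -> L x.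
Proof. exact: lattice_form_bidual. Qed.
Let LdB x y : Ld x -> Ld y -> Ld (x - y).
Proof. by move=> xL yL z Lz; rewrite symfDl symfNl rpredB ?xL ?yL. Qed.

Let IB (u v : subvs_of U) : I u -> I v -> I (u - v).
Proof. exact: LB. Qed.
Let IN (u : subvs_of U) : I u -> I (- u). Proof. exact: LN. Qed.
Let ID (u v : subvs_of U) : I u -> I v -> I (u + v).
Proof. exact: LD. Qed.

Lemma tlift_Ld f : Ist f -> Ld (tlift f).
Proof.
have [Itl ItL [_ _ Isur]] := unimIt.
move=> /Isur[t tI <-]; rewrite tlift_pairing; first exact: ItL.
exact: is_lattice_sub tI.
Qed.

Lemma cF_Ld v : Ld v -> Ist (cF v).
Proof. by move=> vL u Iu; rewrite cFE_pairing pairingE vL. Qed.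

Lemma Ld_orthU u w f : Ld (emb u w f) -> Ld (emb u w 0).
Proof.
move=> vL; have -> : emb u w 0 = emb u w f - tlift f.
  by rewrite -embT embN embD !(oppr0, addr0) subrr.
by apply: LdB => //; apply: tlift_Ld; have := cF_Ld vL; rewrite cF_emb.
Qed.

Lemma I_bidual u : (forall f, Ist f -> f u \is a Num.int) -> I u.
Proof.
move=> uint; apply: L_bidual => v vL.
rewrite symf_sym -pairingE -cFE_pairing; apply: uint; exact: cF_Ld.
Qed.

(** For f in I^* the vector [tlift f] of L^* pairs with [emb u w 0] to f u, so the U-component is
    integral by itself. *)
Lemma L_emb u w : L (emb u w 0) <-> I u /\ L (wlift w).
Proof.
split=> [uwL|[Iu wL]]; last by rewrite /emb linear0 addr0; exact: LD.
have Iu : I u.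
  apply: I_bidual => f /tlift_Ld fL; have := fL _ uwL.
  rewrite -embT form_emb.
  by rewrite !(linear0, zero_lfunE, symf0l, add0r, addr0, mulr0).
split=> //; have -> : wlift w = emb u w 0 - vsval u.
  by rewrite -embW -embU embN embD subrr !(oppr0, addr0).
exact: LB.
Qed.

Lemma LamP w : Lam w <-> L (wlift w).
Proof.
split=> [[x xL <-]|wL]; last first.
  by exists (vsproj (orthov B U) (wlift w)); rewrite ?p_wlift //
    /lattice_in /= vsprojK ?wlift_orthU.
have xE : vsval x = emb (cU (vsval x)) (cW (vsval x)) 0.
  by rewrite -{1}(embK (vsval x)) (orthU_cF (subvsP x)).
have -> : p x = cW (vsval x) by rewrite -[x]vsvalK {1}xE p_emb vsvalK.
by move: xL; rewrite /lattice_in /= xE => /L_emb[_]; rewrite cW_emb.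
Qed.

Lemma cW_Ld v : Ld v -> Lamd (cW v).
Proof.
move=> vL l /LamP lL; have := vL _ lL.
rewrite -{1}(embK v) -embW form_emb.
by rewrite !(linear0, zero_lfunE, add0r, addr0, mulr0).
Qed.

Lemma Lam_bidual w : (forall l, Lamd l -> BW w l \is a Num.int) -> Lam w.
Proof.
move=> wint; apply/LamP/L_bidual => v /cW_Ld/wint.
rewrite -{2}(embK v) -embW form_emb.
by rewrite !(linear0, zero_lfunE, add0r, addr0, mulr0).
Qed.

Lemma LamB w w' : Lam w -> Lam w' -> Lam (w - w').
Proof.
by move=> /LamP wL /LamP wL'; apply/LamP; rewrite linearB; exact: LB.
Qed.

Lemma Lam_dual : Lam `<=` Lamd.
Proof.
move=> w /LamP wL w' /LamP wL'; rewrite -form_WW; exact: (LdL wL).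
Qed.

Lemma Ist_lattice : is_lattice fullv Ist.
Proof.
have [Itl _ [Isub _ Isur]] := unimIt.
have pE v : linfun (pairing B U) v = pairing B U v.
  exact: linfunE pairing_linear v.
have -> : Ist = linfun (pairing B U) @` It.
  apply/seteqP; split=> [f /Isur[t tI <-]|_ [t tI <-]].
    by exists t; rewrite ?pE.
  by rewrite pE; exact: Isub.
apply: lattice_image Itl _; apply/vspaceP => f; rewrite memvf.
have [t tU <-] := Ut_onto f; by apply/memv_imgP; exists t; rewrite ?pE.
Qed.

Lemma I_lattice : is_lattice fullv I.
Proof.
have -> : I = [set u | forall f : dual (subvs_of U),
    Ist f -> f u \is a Num.int].
  apply/seteqP; split=> u; last exact: I_bidual.
  by move=> Iu f; apply.
exact/predual_lattice/Ist_lattice.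
Qed.

(** A functional integral on the image of L is evaluation at some u in U, and then u lies in L^*. In
    [corrL] this converts triviality of M on I_{L^*} modulo I into liftability to L. *)
Lemma cF_L_bidual (f : dual (subvs_of U)) :
  (forall u, Id u -> f u \is a Num.int) -> (cF @` L) f.
Proof.
move=> fint; apply: lattice_bidual.
  apply: lattice_image latL _; apply/vspaceP => g; rewrite memvf.
  by apply/memv_imgP; exists (tlift g); rewrite ?memvf // -embT cF_emb.
move=> phi phiL; have [u uE] := bidual_eval phi.
rewrite uE; apply: fint => x xL.
rewrite symf_sym -pairingE -cFE_pairing -uE; apply: phiL.
by exists x.
Qed.

(** The image of L in U^* is a lattice, hence free: preimages in L of a basis define the section. *)
Lemma L_section : exists xh : 'Hom(dual (subvs_of U), V),
  (forall f, cF (xh f) = f) /\ (forall f, (cF @` L) f -> L (xh f)).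
Proof.
have : is_lattice fullv (cF @` L).
  apply: lattice_image latL _; apply/vspaceP => g; rewrite memvf.
  by apply/memv_imgP; exists (tlift g); rewrite ?memvf // -embT cF_emb.
move=> /lattice_basis[b [bb TE]].
have /choice[x xP] : forall i : 'I_(\dim {:dual (subvs_of U)}),
    exists x, L x /\ cF x = b`_i.
  move=> i; have : (cF @` L) b`_i.
    by apply/TE => j; rewrite coord_free ?(basis_free bb) //; case: eqP.
  by move=> [x xL xb]; exists x.
pose h f := \sum_i coord b i f *: x i.
have hlin : linear h.
  move=> a f g; rewrite /h scaler_sumr -big_split; apply: eq_bigr => i _.
  by rewrite linearP scalerDl scalerA.
exists (linfun h); split=> f; rewrite (linfunE hlin) /h.
  rewrite linear_sum {2}[f](coord_basis bb (memvf f)); apply: eq_bigr => i _.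
  by rewrite linearZ /=; have [_ ->] := xP i.
move=> /TE fb; have [a aE] := choice (fun i => intrP (fb i)).
elim/big_rec: _ => [|i y _ yL]; first exact: L0.
apply: LD => //; rewrite aE scaler_int.
have [xL _] := xP i.
have xn n : L (x i *+ n).
  by elim: n => [|n IH]; rewrite ?mulr0n ?mulrS; [exact: L0|exact: LD].
by case: (a i) => n; rewrite ?NegzE ?mulrNz; [exact: xn|apply: LN; exact: xn].
Qed.

(* Since xh splits cF over the integers, uh w + w is orthogonal to the
   complement xh (cF L) of U^perp in L, hence integral on L for w in Lam^*. *)
Lemma Lamd_lift : exists (xh : 'Hom(dual (subvs_of U), V))
    (uh : 'Hom(W, subvs_of U)),
  [/\ forall f, cF (xh f) = f, forall f, (cF @` L) f -> L (xh f),
      forall w (f : dual (subvs_of U)), f (uh w) = - B (wlift w) (xh f) &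
      forall w, Lamd w -> Ld (emb (uh w) w 0)].
Proof.
have [xh [xhF xhL]] := L_section.
pose e := vbasis {:subvs_of U}.
pose d := @dual_vbasis (subvs_of U).
(* The vector of U that represents the functional f |-> - B (wlift w) (xh f) on U^*, written in a
   basis. *)
pose h w := - \sum_(i < \dim {:subvs_of U}) B (wlift w) (xh (d i)) *: e`_i.
have hlin : linear h.
  move=> a w w'; rewrite /h scalerN -opprD scaler_sumr -big_split; congr (- _).
  apply: eq_bigr => i _.
  by rewrite (linearP wlift) symfDl symfZl scalerDl scalerA.
have uE w (f : dual (subvs_of U)) : f (linfun h w) = - B (wlift w) (xh f).
  have -> : xh f = \sum_(i < \dim {:subvs_of U}) f e`_i *: xh (d i).
    rewrite {1}(dual_vbasis_sum f) linear_sum.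
    by apply: eq_bigr => i _; rewrite linearZ.
  rewrite (linfunE hlin) /h dualN linear_sum linear_sumr.
  congr (- _); apply: eq_bigr => i _.
  by rewrite /= symfZr dualZ mulrC.
exists xh, (linfun h); split=> // w wd x xL.
have xE : x = (x - xh (cF x)) + xh (cF x) by rewrite subrK.
have yL : L (x - xh (cF x)) by apply: LB => //; apply: xhL; exists x.
have yE : x - xh (cF x) = emb (cU (x - xh (cF x))) (cW (x - xh (cF x))) 0.
  by rewrite -{1}(embK (x - _)); congr emb; rewrite linearB /= xhF subrr.
rewrite xE symfDr rpredD //.
  move: yL; rewrite yE => /L_emb[_ /LamP/wd].
  rewrite form_emb.
  by rewrite !(linear0, zero_lfunE, add0r, addr0, mulr0).
rewrite /emb linear0 addr0 symfDl symf_sym -pairingE -cFE_pairing xhF uE.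
by rewrite addNr.
Qed.

Lemma Gamma_L_intro (R : realType) (A : 'End(V)) : isometry B B A ->
  real_SOplus B (real_mx R A) -> (forall nu, Ld nu -> L (A nu - nu)) ->
  Gamma R B L A.
Proof.
move=> iso SO triv; split=> //; apply: (isometry_lattice ndB LB) => //.
Qed.

Lemma Gamma_Lam_intro (R : realType) (gamma : 'End(W)) : isometry BW BW gamma ->
  real_SOplus BW (real_mx R gamma) ->
  (forall nu, Lamd nu -> Lam (gamma nu - nu)) -> Gamma R BW Lam gamma.
Proof.
move=> iso SO triv; split=> //; apply: (isometry_lattice ndBW LamB) => //.
  exact: Lam_dual.
exact: Lam_bidual.
Qed.

(** * The integral Heisenberg group *)

Lemma adjoint_Lam (psi : 'Hom(W, subvs_of U)) f :
  Hom_lattice Lamd I psi -> Ist f -> Lam (adjoint BW psi f).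
Proof.
move=> psiL fI; apply: Lam_bidual => l lL; rewrite adjointE ?ndBW //.
exact/fI/psiL.
Qed.

(** A v - v has no component in U^*, so [L_emb] tests its components in U and W separately. *)
Lemma Heisenberg_Gamma (R : realType) x : integral_Heisenberg BW Lamd I x ->
  (Gamma R B L `&` unipotent_radical p) (unipotent_elt BW p alpha x).
Proof.
case: x => psi eta [/= psiL anti etaL psietaL]; split.
  apply: Gamma_L_intro; first exact: unipotent_isometry.
    exact/real_parabolic0_SOplus/unipotent_component0.
  move=> v vL; have := cF_Ld vL; have := cW_Ld vL.
  rewrite -(embK v); move: (cU v) (cW v) (cF v) => u w f.
  rewrite cW_emb cF_emb => wL fL.
  rewrite unipotent_emb embN embD subrr [_ + _ - w]addrC addKr.
  apply/L_emb; split; last exact/LamP/adjoint_Lam.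
  have := psietaL _ fL; rewrite add_lfunE scale_lfunE comp_lfunE => H.
  have -> : u - psi w - 2^-1 *: psi (adjoint BW psi f) - eta f - u =
      - psi w - (2^-1 *: psi (adjoint BW psi f) + eta f).
    by apply: (canLR (addrK u)); rewrite [RHS]addrC opprD !addrA.
  by apply: IB => //; apply: IN; exact: psiL.
have AU (u : subvs_of U) :
    unipotent_elt BW p alpha (psi, eta) (vsval u) = vsval u.
  by rewrite parabolic_U id_lfunE.
split; first exact: unipotent_isometry.
- apply/vspaceP => v; apply/memv_imgP/idP => [[u uU ->]|vU].
    by rewrite -(vsprojK uU) AU vsprojK.
  by exists v => //; rewrite -(vsprojK vU) AU.
- by move=> u uU; rewrite -(vsprojK uU) AU.
- move=> y; have yE : vsval y = emb (cU (vsval y)) (cW (vsval y)) 0.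
    by rewrite -{1}(embK (vsval y)) (orthU_cF (subvsP y)).
  rewrite -[y in RHS]vsvalK yE unipotent_emb !(linear0, scaler0, subr0, addr0).
  by rewrite !p_emb.
Qed.

Lemma unipotent_elt_inj x y :
  unipotent_elt BW p alpha x = unipotent_elt BW p alpha y -> x = y.
Proof.
case: x y => [psi eta] [phi rho] e.
have psiE : psi = phi.
  apply/lfunP => w.
  have /(congr1 cU) := congr1 (fun A : 'End(V) => A (wlift w)) e.
  rewrite -embW !unipotent_emb !cU_emb.
  by rewrite !(linear0, scaler0, oppr0, addr0, add0r) => /oppr_inj.
congr (_, _) => //; apply/lfunP => f.
have /(congr1 cU) := congr1 (fun A : 'End(V) => A (tlift f)) e.
rewrite -embT !unipotent_emb !cU_emb psiE.
by move=> /addrI/oppr_inj.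
Qed.

(** Fixing U pointwise, A preserves the U^*-coordinate. The W-component on [Ut] is then forced by
    the orthogonality of [Ut] and [Wt], and the form on [Ut] makes eta antisymmetric. *)
Lemma Gamma_Heisenberg (R : realType) (A : 'End(V)) :
  (Gamma R B L `&` unipotent_radical p) A ->
  exists2 x, integral_Heisenberg BW Lamd I x & unipotent_elt BW p alpha x = A.
Proof.
move=> [[iso _ _ triv] [_ _ AU Ap]].
have AUs (u : subvs_of U) : A (vsval u) = vsval u by rewrite AU ?subvsP.
have AcF v : cF (A v) = cF v.
  by apply: dualP => u; rewrite !cFE_pairing !pairingE -{1}AUs iso.
pose psi : 'Hom(W, subvs_of U) := (- (cU \o A \o wlift))%VF.
have AW w : A (wlift w) = emb (- psi w) w 0.
  have e : A (wlift w) = emb (- psi w) (cW (A (wlift w))) 0.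
    rewrite -{1}(embK (A (wlift w))) AcF -embW cF_emb embW.
    by rewrite opp_lfunE opprK !comp_lfunE.
  have := Ap (vsproj (orthov B U) (wlift w)).
  rewrite vsprojK ?wlift_orthU // p_wlift {1}e p_emb => cWA.
  by rewrite e cWA.
clearbody psi.
have AT f : exists c, A (tlift f) = emb c (adjoint BW psi f) f.
  exists (cU (A (tlift f))); rewrite -{1}(embK (A (tlift f))) AcF -embT cF_emb.
  congr emb; rewrite embT.
  apply/eqP; rewrite -subr_eq0; apply/eqP.
  have /nondegenerateP := ndBW; apply => w.
  rewrite symfDl symfNl adjointE ?ndBW //.
  have := iso (tlift f) (wlift w); rewrite AW [RHS]symf_sym form_WT.
  rewrite -{1}(embK (A (tlift f))) form_emb AcF -embT cF_emb embT dualN.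
  rewrite !(zero_lfunE, linear0, mulr0, addr0).
  by rewrite addrC.
(* The coordinate formula on [Ut], solved for eta. *)
pose eta : 'Hom(dual (subvs_of U), subvs_of U) :=
  (- (cU \o A \o tlift) - 2^-1 *: (psi \o adjoint BW psi))%VF.
have cUA f : cU (A (tlift f)) = - (2^-1 *: psi (adjoint BW psi f)) - eta f.
  rewrite /eta add_lfunE !opp_lfunE scale_lfunE !comp_lfunE opprB opprK.
  by rewrite addKr.
clearbody eta.
have {}AT f : A (tlift f) =
    emb (- (2^-1 *: psi (adjoint BW psi f)) - eta f) (adjoint BW psi f) f.
  by have [c cE] := AT f; have := cUA f; rewrite cE cU_emb => ->.
have AE : unipotent_elt BW p alpha (psi, eta) = A.
  apply/lfunP => v; have [u [w [f ->]]] := embP v.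
  rewrite unipotent_emb [in RHS]/emb !linearD /= AUs AW AT -embU !embD.
  by rewrite !addr0 !add0r !addrA.
have anti : antisymmetric_map eta.
  move=> f g; have := iso (tlift f) (tlift g).
  rewrite !AT form_emb form_TT adjointE ?ndBW // !dualE.
  have := symf_sym BW (adjoint BW psi f) (adjoint BW psi g).
  rewrite !adjointE ?ndBW // => -> H.
  by lra.
exists (psi, eta) => //.
have [xh [uh [_ _ _ uhL]]] := Lamd_lift.
(* For w in the dual of [Lam], [wlift w] may fail to lie in L^*; uh w + w does lie there, and A
   moves it by -psi w. *)
have psiL : Hom_lattice Lamd I psi.
  move=> w /uhL wL; have := triv _ wL; rewrite -AE unipotent_emb.
  rewrite !(linear0, scaler0, subr0, addr0) embN embD !subrr.
  by rewrite addrC addKr => /L_emb[/IN]; rewrite opprK.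
have main f : Ist f -> I ((2^-1 *: (psi \o adjoint BW psi) + eta)%VF f).
  move=> /tlift_Ld fL; have := triv _ fL; rewrite AT -embT embN embD subrr.
  rewrite !subr0 => /L_emb[/IN + _].
  rewrite opprD !opprK => H; rewrite add_lfunE scale_lfunE comp_lfunE.
  exact: H.
split=> // f fI; rewrite /half_lattice /=.
have := main _ fI; rewrite add_lfunE scale_lfunE comp_lfunE => H.
(* Twice the integral map psi psi^*/2 + eta, minus psi psi^*, which also maps I^* into I. *)
have -> : 2 *: eta f = (2^-1 *: psi (adjoint BW psi f) + eta f) +
   (2^-1 *: psi (adjoint BW psi f) + eta f) - psi (adjoint BW psi f).
  have h : 2^-1 + 2^-1 = 1 :> rat by lra.
  rewrite addrACA -scalerDl h scale1r.
  by rewrite [psi _ + _]addrC addrK scaler_nat mulr2n.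
by apply: IB; [exact: ID|apply/psiL/Lam_dual/adjoint_Lam].
Qed.

(** * The cocycle and the image in the quotient *)

Section Cocycle.
Variables (xh : 'Hom(dual (subvs_of U), V)) (uh : 'Hom(W, subvs_of U)).
Hypothesis xhF : forall f, cF (xh f) = f.
Hypothesis xhL : forall f, (cF @` L) f -> L (xh f).
Hypothesis uhE : forall w (f : dual (subvs_of U)),
  f (uh w) = - B (wlift w) (xh f).
Hypothesis uhL : forall w, Lamd w -> Ld (emb (uh w) w 0).

Local Notation K := (Hom_lattice Lamd I).
Let lift_diff (M : 'End(subvs_of U)) : 'Hom(W, subvs_of U) :=
  ((M - \1) \o uh)%VF.

(** Formally the coboundary of [uh]. But [uh] is only known to map [Lam] into I_{L^*}, and it is M -
    1 that lands in I, so this need not be a coboundary with values in Hom(Lam, I). *)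
Definition cocycle (M : 'End(subvs_of U)) : set 'Hom(W, subvs_of U) :=
  Hom_class K (lift_diff M).

Let lift_diffE M w : lift_diff M w = M (uh w) - uh w.
Proof. by rewrite comp_lfunE add_lfunE opp_lfunE id_lfunE. Qed.

Lemma Hom_LamdB f g : K f -> K g -> K (f - g).
Proof.
move=> fK gK w wL; rewrite add_lfunE opp_lfunE.
by apply: IB; [exact: fK|exact: gK].
Qed.

Lemma Hom_Lamd0 : K 0.
Proof. by move=> w _; rewrite zero_lfunE; exact: L0. Qed.

Lemma Hom_class_eq f g : K (f - g) -> Hom_class K f = Hom_class K g.
Proof.
move=> fg; apply/seteqP; split=> h; rewrite /Hom_class /= => hK.
  have -> : h - g = (h - f) - (0 - (f - g)).
    by rewrite sub0r opprK addrA subrK.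
  by apply: Hom_LamdB => //; apply: Hom_LamdB => //; exact: Hom_Lamd0.
have -> : h - f = (h - g) - (f - g) by rewrite opprB addrA subrK.
exact: Hom_LamdB.
Qed.

Lemma Hom_class_mem f : Hom_class K f f.
Proof. by rewrite /Hom_class /= subrr; exact: Hom_Lamd0. Qed.

Lemma cocycle_mem M phi : cocycle M = Hom_class K phi -> K (phi - lift_diff M).
Proof. by move=> e; have := Hom_class_mem phi; rewrite -e. Qed.

Lemma uh_Id w : Lam w -> Id (uh w).
Proof.
move=> wL; have wLd : Lamd w by exact: Lam_dual.
rewrite /lattice_in /= (_ : vsval _ = emb (uh w) w 0 - wlift w).
  by apply: LdB; [exact: uhL|exact/LdL/LamP].
by rewrite -embU -embW embN embD subrr !(oppr0, addr0).
Qed.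

Lemma cocycle_Hom M : SL_rel Id I M -> Hom_lattice Lam I (lift_diff M).
Proof.
move=> [_ MI] w /uh_Id/MI/IN; rewrite opprB lift_diffE.
by [].
Qed.

(** (MN - 1)u = (M - 1)u + M(N - 1)u. For arbitrary representatives the error contains M(psi - (N -
    1)u), which is integral because M preserves I. *)
Lemma cocycleM M N phi psi : SL_rel Id I M ->
  cocycle M = Hom_class K phi -> cocycle N = Hom_class K psi ->
  cocycle (M \o N)%VF = Hom_class K (phi + (M \o psi)%VF).
Proof.
move=> [[_ MI] _] /cocycle_mem phiM /cocycle_mem psiN.
apply/esym/Hom_class_eq => w wL.
have := phiM _ wL; have := psiN _ wL.
rewrite !add_lfunE !opp_lfunE !lift_diffE !comp_lfunE => Hp Hf.
have HM : I (M (psi w - (N (uh w) - uh w))).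
  by rewrite -MI; exists (psi w - (N (uh w) - uh w)).
have -> : phi w + M (psi w) - (M (N (uh w)) - uh w) =
    (phi w - (M (uh w) - uh w)) + M (psi w - (N (uh w) - uh w)).
  rewrite !(linearB M) /= addrACA -opprD [M (uh w) - uh w + _]addrC.
  by rewrite addrA subrK.
exact: ID.
Qed.

(** * Necessary conditions on the coordinates *)

Section Forward.
Variable R : realType.
Variables (M : 'End(subvs_of U)) (gamma : 'End(W)).
Variables (psi : 'Hom(W, subvs_of U)).
Variable eta : 'Hom(dual (subvs_of U), subvs_of U).
Local Notation A := (parabolic_elt BW p alpha M gamma psi eta).

Lemma Gamma_LI_coords : Gamma_LI R B U L A ->
  [/\ SL_rel Id I M, Gamma R BW Lam gamma, Hom_lattice Lam I psi &
      cocycle M = Hom_class K psi].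
Proof.
move=> [PA [iso AL _ triv]].
have kA : lker A == 0%VS by exact: (isometry_lker ndB).
have AU u : A (vsval u) = vsval (M u) by exact: parabolic_U.
have kM : lker M == 0%VS.
  rewrite -subv0; apply/subvP => u; rewrite memv_ker memv0 => /eqP Mu.
  apply/eqP/val_inj; rewrite /= -(lker0_lfunK kA (vsval u)) AU Mu.
  by rewrite linear0.
have MI : M @` I = I.
  apply/seteqP; split=> [_ [u Iu <-]|v Iv].
    by rewrite /lattice_in /= -AU -AL; exists (vsval u).
  exists ((M^-1)%VF v); last by rewrite lker0_lfunVK_end.
  have : (A @` L) (vsval v) by rewrite AL.
  move=> [x xL xv]; rewrite /lattice_in /= -(lker0_lfunK kA (vsval _)) AU.
  by rewrite lker0_lfunVK_end // -xv lker0_lfunK.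
have dM : end_det M = 1.
  apply: (end_det_lattice_aut I_lattice) => //.
  exact: (real_parabolic0_det_gt0 PA).
have AW w : A (wlift w) = emb (- psi (gamma w)) (gamma w) 0.
  rewrite -embW parabolic_emb.
  by rewrite !(linear0, scaler0, oppr0, addr0, add0r).
have isog : isometry BW BW gamma.
  move=> w w'; rewrite -[RHS]form_WW -iso !AW form_emb.
  by rewrite !(linear0, zero_lfunE, add0r, addr0, mulr0).
(* Triviality on L^*/L, applied to uh w + w: the U-component gives the congruence for psi, the
   W-component the triviality of gamma. *)
have diff w : Lamd w ->
    I (M (uh w) - psi (gamma w) - uh w) /\ Lam (gamma w - w).
  move=> /uhL/triv; rewrite parabolic_emb.
  rewrite !(linear0, scaler0, oppr0, addr0, add0r) embN embD subrr.
  by move=> /L_emb[? ?]; split=> //; exact/LamP.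
have Gg : Gamma R BW Lam gamma.
  apply: Gamma_Lam_intro => //.
    by apply: (parabolic0_gamma PA) => w; rewrite AW cW_emb.
  by move=> w /diff[].
have psiL : Hom_lattice Lam I psi.
  case: Gg => _ gL _ _ w; rewrite -{1}gL => -[w' /LamP wL <-].
  have : L (A (wlift w')) by rewrite -AL; exists (wlift w').
  by rewrite AW => /L_emb[/IN + _]; rewrite opprK.
split=> //; first split=> //.
  move=> u /triv; rewrite AU => /LN; rewrite opprB.
  by [].
apply/esym/Hom_class_eq => w wL; rewrite add_lfunE opp_lfunE lift_diffE.
have [H1 H2] := diff _ wL.
(* psi(gamma w) may be replaced by psi w: gamma w - w lies in [Lam], where psi takes values in I. *)
have -> : psi w - (M (uh w) - uh w) =
    (0 - (M (uh w) - psi (gamma w) - uh w)) - psi (gamma w - w).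
  rewrite (linearB psi) /= sub0r -opprD [M (uh w) - _ - _]addrAC.
  by rewrite addrA subrK [RHS]opprB.
apply: IB; last exact: psiL.
by apply: IB => //; exact: L0.
Qed.

End Forward.

(** * Construction of a lift from the coordinates *)

Section Backward.
Variable R : realType.
Variables (M : 'End(subvs_of U)) (gamma : 'End(W)).
Variables (psi : 'Hom(W, subvs_of U)).
Hypothesis SM : SL_rel Id I M.
Hypothesis Gg : Gamma R BW Lam gamma.
Hypothesis psiL : Hom_lattice Lam I psi.
Hypothesis psiM : cocycle M = Hom_class K psi.

Let kappa := psi - lift_diff M.
Let A eta := parabolic_elt BW p alpha M gamma psi eta.
Let M' := ((dual_map M)^-1)%VF.

Let kappaK : K kappa. Proof. exact: cocycle_mem. Qed.
Let dM : end_det M = 1. Proof. by case: SM => -[]. Qed.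
Let kM : lker M == 0%VS.
Proof. by apply: end_det_lker; rewrite dM oner_eq0. Qed.
Let MI : M @` I = I. Proof. by case: SM => -[]. Qed.

Let M'K s : M' (dual_map M s) = s.
Proof. by apply/esym/dual_map_inv_unique => // x; rewrite dual_mapE. Qed.

Let M'VK f : dual_map M (M' f) = f.
Proof. by apply: dualP => x; rewrite dual_mapE dual_map_inv. Qed.

(* Modulo U, the isometry A 0 moves tlift (dual_map M s) by the element corr s
   of L; the defect F s has to be made integral by a choice of eta. *)
Let corr : 'Hom(dual (subvs_of U), V) :=
  ((xh \o (\1 - dual_map M)) + (wlift \o adjoint BW kappa))%VF.

Let corrE s : corr s = xh (s - dual_map M s) + wlift (adjoint BW kappa s).
Proof. by rewrite add_lfunE !comp_lfunE add_lfunE opp_lfunE id_lfunE. Qed.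

Let corrL s : Ist s -> L (corr s).
Proof.
move=> sI; rewrite corrE; apply: LD; last exact/LamP/adjoint_Lam.
(* Since u - M u lies in I for u in I_{L^*}, the functional s - M^* s is integral on I_{L^*}. *)
apply: xhL; apply: cF_L_bidual => u uI.
rewrite add_lfunE opp_lfunE dual_mapE -dualN -dualD; apply: sI.
by case: SM => _; apply.
Qed.

Let F : 'Hom(dual (subvs_of U), subvs_of U) :=
  (cU \o ((A 0 \o tlift \o dual_map M) - (tlift \o dual_map M) - corr))%VF.

Let AF s : A 0 (tlift (dual_map M s)) =
  tlift (dual_map M s) + corr s + vsval (F s).
Proof.
pose x := A 0 (tlift (dual_map M s)) - tlift (dual_map M s) - corr s.
suff xE : x = vsval (F s).
  by rewrite -xE /x [RHS]addrC -(addrA (A 0 _)) -opprD subrK.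
have -> : F s = cU x.
  rewrite /F comp_lfunE; congr (cU _).
  by rewrite 2!add_lfunE 2!opp_lfunE 3!comp_lfunE.
rewrite -embU -{1}(embK x).
have xF : cF x = 0.
  rewrite /x corrE !(linearB cF) (linearD cF) /= xhF -!embT -embW !cF_emb.
  rewrite /A parabolic_emb cF_emb -/M' M'K addr0.
  by rewrite opprB addrA subrK subrr.
have xW : cW x = 0.
  have /nondegenerateP := ndBW; apply => w.
  rewrite /x corrE !(linearB cW) (linearD cW) /= -!embT -embW !cW_emb.
  rewrite /A parabolic_emb cW_emb -/M' M'K linear0 add0r subr0.
  rewrite symfDl symfNl symfDl !adjointE ?ndBW //.
  (* The W-component of [xh] is minus the dual of [uh]; this and kappa^* s add up to psi^* s. *)
  have -> : BW (cW (xh (s - dual_map M s))) w =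
      - (s - dual_map M s : dual _) (uh w).
    rewrite uhE opprK symf_sym -{2}(embK (xh _)) -embW form_emb.
    by rewrite !(linear0, zero_lfunE, add0r, addr0, mulr0).
  rewrite add_lfunE opp_lfunE dual_mapE /kappa add_lfunE opp_lfunE lift_diffE.
  by rewrite !dualE; ring.
by rewrite xF xW.
Qed.

(* Compare the norms of the two sides of AF: L is even. *)
Let F_int (s : dual (subvs_of U)) : Ist s -> s (F s) \is a Num.int.
Proof.
move=> sI.
have tI : Ist (dual_map M s).
  by move=> u uI; rewrite dual_mapE; apply: sI; rewrite -MI; exists u.
have tL := tlift_Ld tI; have yL := corrL sI.
have iso : isometry B B (A 0).
  apply: parabolic_isometry => //; first by case: Gg.
  exact: antisymmetric0.
have := iso (tlift (dual_map M s)) (tlift (dual_map M s)).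
rewrite AF.
set t := tlift _; set y := corr s; set x := vsval _.
have xx : B x x = 0 by exact: form_UU.
(* The U^*-coordinate of t + y is s, so its pairing with F s is the number to be controlled. *)
have tyx : B (t + y) x = s (F s).
  rewrite -pairingE -cFE_pairing linearD /= /t /y corrE linearD /= xhF.
  rewrite -embT -embW !cF_emb addr0 addrC subrK.
  by [].
rewrite symfDl !(symfDr _ _ x) xx tyx (symf_sym B x) tyx.
rewrite !symfE (symf_sym B y t) => H.
have -> : s (F s) = - B t y - B y y / 2 by lra.
rewrite rpredB ?rpredN; [by []|exact: tL|].
by case: evenL => _; apply.
Qed.

Lemma bar_image_intro : exists2 eta, antisymmetric_map eta &
  Gamma_LI R B U L (A eta).
Proof.
have [eta anti etaI] := antisymmetric_integral_part Ist_lattice F_int.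
have [isog gL gSO gtriv] := Gg.
exists eta => //; have PA : real_parabolic0 B U (real_mx R (A eta)).
  exact: parabolic_component0.
split=> //; apply: Gamma_L_intro.
- exact: parabolic_isometry.
- exact: real_parabolic0_SOplus PA.
move=> v vL; have := cF_Ld vL; move: vL.
rewrite -(embK v); move: (cU v) (cW v) (cF v) => u w f vL.
rewrite cF_emb => fI.
have uwL := Ld_orthU vL.
have -> : emb u w f = emb u w 0 + tlift f by rewrite -embT embD !(addr0, add0r).
rewrite linearD /= opprD addrACA; apply: LD.
  have wL : Lamd w by have := cW_Ld uwL; rewrite cW_emb.
  rewrite /A parabolic_emb.
  rewrite !(linear0, scaler0, oppr0, addr0, add0r) embN embD subrr.
  have gw := gtriv _ wL.
  apply/L_emb; split; last exact/LamP.
  (* The given vector is uh w + w plus [v0]; its excess [v0] lies in I_{L^*}, where M is trivial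
     modulo I. *)
  pose v0 := u - uh w.
  have v0I : Id v0.
    have := LdB uwL (uhL wL); rewrite embN embD !subrr embU.
    by [].
  have Mv0 : I (v0 - M v0) by case: SM => _; apply.
  have kw : I (kappa w) by exact: kappaK.
  have pw : I (psi (gamma w - w)) by exact: psiL.
  have -> : M u - psi (gamma w) - u =
      (0 - (v0 - M v0)) - kappa w - psi (gamma w - w).
    rewrite /v0 /kappa add_lfunE opp_lfunE lift_diffE.
    rewrite (linearB psi) (linearB M) /= sub0r opprB.
    move: (M u) (uh w) (M (uh w)) (psi w) (psi (gamma w)) => a d b q g.
    rewrite -[RHS]addrA -opprD [q - _ + _]addrC addrA subrK (opprB g) addrA.
    rewrite [a - b - _ + _]addrAC [a - b + _]addrA subrK (opprB u) addrA subrK.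
    exact: addrAC.
  by apply: IB => //; apply: IB => //; apply: IB => //; exact: L0.
(* The summand from [Ut] is parametrised by s = M^{-*} f, again in I^*, because [corr] and [F] are
   functions of s. *)
pose s := M' f.
have sI : Ist s.
  move=> u'; rewrite -{1}MI => -[u'' uI <-].
  by rewrite /s dual_map_inv //; exact: fI.
have AE : A eta (tlift f) = A 0 (tlift f) - vsval (eta s).
  rewrite -embT /A !parabolic_emb -embU embN embD zero_lfunE.
  rewrite !(subr0, oppr0, addr0).
  by rewrite -!addrA.
have fE : f = dual_map M s by rewrite M'VK.
rewrite AE fE AF.
have -> : tlift (dual_map M s) + corr s + vsval (F s) - vsval (eta s) -
    tlift (dual_map M s) = corr s + vsval (F s - eta s).
  by apply: (canLR (addrK _)); rewrite [RHS]addrC !addrA.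
apply: LD; first exact: corrL.
by apply: I_bidual => t tI; exact: etaI.
Qed.

End Backward.

Lemma bar_image_Gamma_LI (R : realType) :
  bar_image BW p alpha (Gamma_LI R B U L) =
    [set x | let: (M, gamma, psi) := x in
       [/\ SL_rel Id I M, Gamma R BW Lam gamma, Hom_lattice Lam I psi &
           cocycle M = Hom_class K psi]].
Proof.
apply/seteqP; split=> [[[M gamma] psi] [eta _] /= H|[[M gamma] psi] /= [*]].
  exact: Gamma_LI_coords H.
exact: bar_image_intro.
Qed.

End Cocycle.

End Arithmetic.

End Coordinates.

(** * From a unimodular pairing of lattices to a perfect pairing over the rationals *)

Section UnimodularComplement.
Variables (V : vectType rat) (B : {symmetric V}) (L : set V).
Variables (U Ut : {vspace V}) (It : set V).
Hypothesis ndB : nondegenerate B.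
Hypothesis evenL : even_lattice B L.
Hypothesis unimIt : unimodular_complement B L U Ut It.

Lemma unimodular_inj t : t \in Ut -> pairing B U t = 0 -> t = 0.
Proof.
have [Itl _ [_ Iinj _]] := unimIt.
move=> tU t0; have [d d0 dt] := is_lattice_multiple Itl tU.
have I0 := is_lattice0 Itl.
have : d%:~R *: t = 0.
  apply: Iinj; rewrite ?inE //.
  rewrite -[X in _ = pairing _ _ X](scale0r (0 : V)) !pairingZ.
  by rewrite t0 scaler0 scale0r.
by move/eqP; rewrite scaler_eq0 intr_eq0 (negPf d0) => /eqP.
Qed.

(** Extended to V, f is represented by a vector x. A multiple d x lies in L, so d f is integral on I
    and comes from [It]. *)
Lemma unimodular_onto f : exists2 t, t \in Ut & pairing B U t = f.
Proof.
have [Itl _ [_ _ Isur]] := unimIt.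
pose g : dual V := (f \o subvs_proj U)%VF.
pose x := ((flat B)^-1)%VF g.
have xf : pairing B U x = f.
  apply: dualP => u; rewrite pairingE -flatE flat_bij // comp_lfunE.
  by rewrite subvs_projE vsvalK.
have [d d0 dx] := lattice_multiple x (proj1 evenL).
have : Zdual (lattice_in U L) (d%:~R *: f).
  move=> u uL; rewrite -xf -pairingZ pairingE.
  exact: (even_lattice_integral evenL dx).
move=> /Isur[t tI tf]; exists (d%:~R^-1 *: t).
  by rewrite rpredZ // (is_lattice_sub Itl tI).
by rewrite pairingZ tf scalerK // intr_eq0.
Qed.

End UnimodularComplement.

(** Classes modulo Hom(Lam^*, I) are sets of representatives. The first clause on [b] says that its
    values are such classes; without it the cocycle rule, which speaks of representatives, could
    hold vacuously. *)
Theorem mainTheorem1 (R : realType)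
    (V : vectType rat) (B : {symmetric V}) (ndB : nondegenerate B)
    (L : set V) (evenL : even_lattice B L)
    (U : {vspace V}) (isoU : (U <= orthov B U)%VS)
    (W : vectType rat) (BW : {symmetric W})
    (p : 'Hom(subvs_of (orthov B U), W)) (subqW : is_subquotient BW p)
    (It : set V) (Ut : {vspace V})
    (unimIt : unimodular_complement B L U Ut It)
    (alpha : 'Hom(subvs_of Ut, subvs_of U)) (alphaP : is_alpha B alpha) :
  let I := lattice_in U L in
  let I_dual := lattice_in U (dual_lattice B L) in
  let Lam := Lambda p L in
  let Lam_dual := dual_lattice BW Lam in
  set_bij (integral_Heisenberg BW Lam_dual I)
          (Gamma R B L `&` unipotent_radical p)
          (unipotent_elt BW p alpha) /\
  exists b : 'End(subvs_of U) -> set 'Hom(W, subvs_of U),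
    [/\ forall M, SL_rel I_dual I M ->
          exists2 psi, Hom_lattice Lam I psi &
            b M = Hom_class (Hom_lattice Lam_dual I) psi,
        forall M N phi psi, SL_rel I_dual I M -> SL_rel I_dual I N ->
          b M = Hom_class (Hom_lattice Lam_dual I) phi ->
          b N = Hom_class (Hom_lattice Lam_dual I) psi ->
          b (M \o N)%VF =
            Hom_class (Hom_lattice Lam_dual I) (phi + (M \o psi)%VF) &
        bar_image BW p alpha (Gamma_LI R B U L) =
          [set x | let: (M, gamma, psi) := x in
             [/\ SL_rel I_dual I M, Gamma R BW Lam gamma,
                 Hom_lattice Lam I psi &
                 b M = Hom_class (Hom_lattice Lam_dual I) psi]]].
Proof.
move=> I I_dual Lam Lam_dual.
have Ut_inj := unimodular_inj unimIt.
have Ut_onto := unimodular_onto ndB evenL unimIt.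
split.
  split.
  - exact: (Heisenberg_Gamma ndB isoU subqW Ut_inj Ut_onto alphaP evenL unimIt).
  - by move=> x y _ _; exact: (unipotent_elt_inj isoU subqW Ut_inj Ut_onto).
  - exact: (Gamma_Heisenberg ndB isoU subqW Ut_inj Ut_onto alphaP evenL unimIt).
have [xh [uh [xhF xhL uhE uhL]]] :=
  Lamd_lift ndB isoU subqW Ut_inj Ut_onto alphaP evenL unimIt.
exists (cocycle BW p L uh); split.
- move=> M SM; exists ((M - \1) \o uh)%VF => //.
  exact: (cocycle_Hom ndB isoU subqW Ut_inj Ut_onto alphaP evenL unimIt uhL).
- by move=> M N phi psi SM _; exact: (cocycleM evenL).
- exact: (bar_image_Gamma_LI ndB isoU subqW Ut_inj Ut_onto alphaP evenL unimIt
    xhF xhL uhE uhL).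
Qed.
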